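(* Let $1\le M\le N$ be integers and let $V:\mathbb{R}_+\to\mathbb{R}\cup\{\infty\}$ be a measurable function such that $$0<\int_{\mathbb{C}^N}\prod_{1\le i<j\le N}|z_i-z_j|^2\,e^{-\sum_{i=1}^NV(|z_i|^2)}\,\mathrm{d}m(z_1)\cdots\mathrm{d}m(z_N)<\infty.$$ Let $\{\lambda_1,\dots,\lambda_N\}$ be distributed according to $\mathrm{E}_{(V)}(N)$. Then we have the equality in distribution of (unordered) random point sets, counted with multiplicity, $$\{\lambda_1^M,\dots,\lambda_N^M\}\stackrel{d}{=}\{z_1^M,\dots,z_N^M\},$$ where, for each $1\le k\le M$, $(z_i)_{i\in I_k}$ is distributed according to $\mathrm{R}_V(N,M,k)$, and these families are independent for different values of $k$. In other words, the distribution of the $M$-th powers of $\mathrm{E}_{(V)}(N)$ is a superposition of $M$ independent Power distributions: $$\mathrm{E}_{(V)}(N)^M\stackrel{d}{=}\bigcup_{k=1}^M\mathrm{R}_V(N,M,k)^M\stackrel{d}{=}\bigcup_{k=1}^M\mathrm{E}(N,M,k).$$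
   Context: $m$ is Lebesgue measure on $\mathbb{C}$. For a point process $\mathrm{P}$, $\mathrm{P}^M$ denotes its image under $z\mapsto z^M$ applied to every point. $\mathrm{E}_{(V)}(N)$ is the random set of $N$ complex points with joint density, with respect to Lebesgue measure on $\mathbb{C}^N$, proportional to $\prod_{i<j}|z_i-z_j|^2\prod_{i=1}^Ne^{-V(|z_i|^2)}$. For $1\le k\le M\le N$, let $I_k=\{i\in\{1,\dots,N\}: i\equiv k\pmod M\}$. The Root distribution $\mathrm{R}_V(N,M,k)$ is the point process indexed by $I_k$ with joint density, with respect to Lebesgue measure on $\mathbb{C}^{I_k}$, proportional to $$\prod_{i<j;\ i,j\in I_k}|z_i^M-z_j^M|^2\prod_{i\in I_k}|z_i|^{2(k-1)}e^{-V(|z_i|^2)}.$$ The Power distribution $\mathrm{E}(N,M,k)$ is the image of $\mathrm{R}_V(N,M,k)$ under $z\mapsto z^M$, that is, the point process indexed by $I_k$ with joint density proportional to $$\prod_{i<j;\ i,j\in I_k}|z_i-z_j|^2\prod_{i\in I_k}|z_i|^{\frac{2(k-M)}{M}}e^{-V(|z_i|^{2/M})}.$$ *)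

(* Defs.v *)
From HB Require Import structures.
From mathcomp Require Import all_boot all_order all_algebra.
From mathcomp Require Import finmap multiset.
From mathcomp Require Import all_classical all_reals all_analysis.
From mathcomp Require Import measurable_realfun.
From mathcomp Require Import complex.

Set Implicit Arguments.
Unset Strict Implicit.
Unset Printing Implicit Defensive.

Import Order.TTheory GRing.Theory Num.Theory.
Import numFieldNormedType.Exports.

Local Open Scope classical_set_scope.
Local Open Scope ring_scope.

Section complex_measurable.
Context (R : realType).

Definition complex_to_pair (z : R[i]) : R * R := (complex.Re z, complex.Im z).

HB.instance Definition _ := isPointed.Build R[i] 0.

Let mC := g_sigma_algebra_preimage complex_to_pair.

Let mC0 : mC set0.
Proof. by exists set0 => //; rewrite preimage_set0 setI0. Qed.

Let mCC A : mC A -> mC (~` A).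
Proof.
move=> -[B mB <-]; exists (~` B); first exact: measurableC.
by rewrite !setTI preimage_setC.
Qed.

Let mC_bigcup (F : (set R[i])^nat) : (forall i, mC (F i)) -> mC (\bigcup_i F i).
Proof.
move=> mF; pose g n := sval (cid2 (mF n)).
have gP n : measurable (g n) /\ complex_to_pair @^-1` g n = F n.
  by rewrite /g; case: (cid2 (mF n)) => /= B mB; rewrite setTI.
exists (\bigcup_i g i); first by apply: bigcup_measurable => n _; case: (gP n).
rewrite setTI preimage_bigcup; apply: eq_bigcupr => n _.
by case: (gP n).
Qed.

(* The Borel sigma-algebra of C, identified with R * R. *)
HB.instance Definition _ := @isMeasurable.Build
  (preimage_display complex_to_pair) R[i] mC mC0 mCC mC_bigcup.

Definition lebesgueC : set R[i] -> \bar R :=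
  pushforward ((@lebesgue_measure R) \x (@lebesgue_measure R))%E
    (fun p : R * R => (p.1 +i* p.2)%C).

Fixpoint lebesgueCn (n : nat) : set (n.-tuple R[i]) -> \bar R :=
  if n is m.+1 then
    pushforward (lebesgueC \x (@lebesgueCn m))%E
      (fun p : R[i] * m.-tuple R[i] => [tuple of p.1 :: p.2])
  else \d_([tuple] : 0.-tuple R[i]).

End complex_measurable.

Section probability_notions.
Context {R : realType}.
Local Open Scope ereal_scope.

Definition normalizable d (T : measurableType d) (mu : set T -> \bar R)
    (f : T -> \bar R) : Prop :=
  0 < \int[mu]_x f x /\ \int[mu]_x f x < +oo.

Definition has_density_propto d (T : measurableType d) (P : probability T R)
    d' (T' : measurableType d') (X : T -> T')
    (mu : set T' -> \bar R) (f : T' -> \bar R) : Prop :=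
  [/\ measurable_fun [set: T] X, normalizable mu f &
    forall A, measurable A ->
      P (X @^-1` A) = ((fine (\int[mu]_x f x))^-1)%:E * \int[mu]_(x in A) f x].

Definition mutually_independent d (T : measurableType d) (P : probability T R)
    (I : finType) (d' : I -> measure_display)
    (T' : forall i, measurableType (d' i)) (X : forall i, T -> T' i) : Prop :=
  forall (J : {set I}) (A : forall i, set (T' i)),
    (forall i, measurable (A i)) ->
    P (\bigcap_(i in [set` J]) (X i @^-1` A i)) =
    \prod_(i in J) P (X i @^-1` A i).

End probability_notions.

Section point_configurations.
Context {R : realType}.

(* The sigma-algebra on finite multisets of complex numbers generated by the
   counting maps S |-> #(S `&` A), A Borel: the law of a point process is its
   image measure on this sigma-algebra. *)
Definition configuration_measurable : set (set {mset R[i]}%mset) :=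
  <<s [set B : set {mset R[i]}%mset | exists2 A : set R[i], measurable A &
         exists n : nat,
           B = [set S | count (fun z : R[i] => z \in A) (enum_mset S) = n] ]>>.

Definition eq_in_law d (T : measurableType d) (P : probability T R)
    d' (T' : measurableType d') (P' : probability T' R)
    (X : T -> {mset R[i]}%mset) (Y : T' -> {mset R[i]}%mset) : Prop :=
  forall B, configuration_measurable B -> P (X @^-1` B) = P' (Y @^-1` B).

Definition points n (z : n.-tuple R[i]) : {mset R[i]}%mset := seq_mset z.

Definition powers (M n : nat) (z : n.-tuple R[i]) : n.-tuple R[i] :=
  [tuple of [seq x ^+ M | x <- z]].

End point_configurations.

Section distributions.
Context {R : realType}.
Implicit Types V : R -> \bar R.
Local Notation modulus := (@ComplexField.Normc.normc R).

Definition vandermonde_sqr n (z : n.-tuple R[i]) : R :=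
  \prod_(i < n) \prod_(j < n | (i < j)%N) modulus (tnth z i - tnth z j) ^+ 2.

Definition ginibre_density V n (z : n.-tuple R[i]) : \bar R :=
  ((vandermonde_sqr z)%:E *
   \prod_(i < n) expeR (- V (modulus (tnth z i) ^+ 2)%R))%E.

(* The element i : 'I_N stands for the integer i + 1 of {1, ..., N}. *)
Definition residue_class (N M k : nat) : {set 'I_N} :=
  [set i : 'I_N | i.+1 == k %[mod M]]%SET.

Definition residue_subfamily (N M k : nat) (z : N.-tuple R[i]) :
    #|residue_class N M k|.-tuple R[i] :=
  [tuple tnth z (enum_val j) | j < #|residue_class N M k|].

Definition root_density V (N M k : nat)
    (z : #|residue_class N M k|.-tuple R[i]) : \bar R :=
  ((vandermonde_sqr (powers M z))%:E *
   \prod_(i < #|residue_class N M k|)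
     ((modulus (tnth z i) ^+ (2 * (k - 1))%N)%:E *
      expeR (- V (modulus (tnth z i) ^+ 2)%R)))%E.

(* For k < M the exponent of the modulus is negative; then [0 `^ _ = 0], which
   only affects the density on a Lebesgue-null set. *)
Definition power_density V (N M k : nat)
    (z : #|residue_class N M k|.-tuple R[i]) : \bar R :=
  ((vandermonde_sqr z)%:E *
   \prod_(i < #|residue_class N M k|)
     ((modulus (tnth z i) `^ (2 * (k%:R - M%:R) / M%:R))%:E *
      expeR (- V (modulus (tnth z i) `^ (2 / M%:R))%R)))%E.

Definition ginibre_law V (N : nat)
    d (T : measurableType d) (P : probability T R) (X : T -> N.-tuple R[i]) :=
  has_density_propto P X (@lebesgueCn R N) (@ginibre_density V N).

Definition root_law V (N M k : nat)
    d (T : measurableType d) (P : probability T R)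
    (X : T -> #|residue_class N M k|.-tuple R[i]) :=
  has_density_propto P X (@lebesgueCn R _) (@root_density V N M k).

Definition power_law V (N M k : nat)
    d (T : measurableType d) (P : probability T R)
    (X : T -> #|residue_class N M k|.-tuple R[i]) :=
  has_density_propto P X (@lebesgueCn R _) (@power_density V N M k).

End distributions.

(* Main.v *)
(** Rotating each point by an [M]-th root of unity does not change its [M]-th
    power, so the squared Vandermonde determinant may be averaged over all
    these rotations.  In the Leibniz expansion of the determinant, group the
    terms according to the residues modulo [M] of the exponents of the points:
    by Parseval's identity on [(Z / M) ^ N], the average is the sum of the
    squared moduli of the groups.  Up to a permutation of the points, each
    nonzero group is a block-diagonal determinant, whose blocks are Vandermonde
    determinants in the [z_i ^ M] times the product of the [z_i ^ (k - 1)].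
    Hence the average is a constant times the symmetrization of the product of
    the root densities.  All the terms are nonnegative, so that no integrability
    has to be checked.

    The image of a root distribution under [z |-> z ^ M] is computed from the
    uniqueness of the Haar measure [|w| ^ -2 dm(w)] of the group [C \ {0}]. *)

Require Import Defs.
From HB Require Import structures.
From mathcomp Require Import all_boot all_order all_algebra.
From mathcomp Require Import fingroup perm cyclic separable cyclotomic.
From mathcomp Require Import finmap multiset.
From mathcomp Require Import all_classical all_reals all_analysis.
From mathcomp Require Import measurable_realfun.
From mathcomp Require Import complex.
From mathcomp Require Import ring lra.
Import Order.TTheory GRing.Theory Num.Theory.
Local Open Scope classical_set_scope.
Local Open Scope ring_scope.

Set Implicit Arguments.
Unset Strict Implicit.
Unset Printing Implicit Defensive.

(** Each law is brought to one normal form: the probability of an event on the configuration is the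
    normalized integral of its indicator, composed with [powers M], against the product of the root
    weights over the residue classes. Constants coming from the average or from Jacobians cancel
    between the integral and its normalization, which is the case of the constant function 1.

    The obstacle is that [lebesgueCn] is built one coordinate at a time, whereas the root families
    live on interleaved blocks of coordinates. The factorization of integrals over these blocks is
    obtained from uniqueness of measures on boxes, without rearranging coordinates. It turns
    independence of the blocks into a joint density, and it makes every root density normalizable,
    since a positive finite product of nonnegative integrals has only positive finite factors.

    The Haar argument determines the image measure only up to a constant. The constant [M] is read
    off an annulus: [1 <= |z| < 2] is the preimage of [1 <= |w| < 2 ^ M], whose Haar mass is [M]
    times as large. *)

Local Notation re := (@complex.Re _).
Local Notation im := (@complex.Im _).
Local Notation normc := (@ComplexField.Normc.normc _).
Local Notation mC := (@lebesgueC _).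
Local Notation leb := (@lebesgue_measure _).

(** * Lebesgue measure on the complex plane *)

Section complex_measurability.
Context {R : realType}.

Lemma measurable_complex_to_pair :
  measurable_fun [set: R[i]] (@complex_to_pair R).
Proof. by move=> _ A mA; exists A. Qed.

Lemma measurable_fun_Re : measurable_fun [set: R[i]] re.
Proof. exact: measurableT_comp measurable_fst measurable_complex_to_pair. Qed.

Lemma measurable_fun_Im : measurable_fun [set: R[i]] im.
Proof. exact: measurableT_comp measurable_snd measurable_complex_to_pair. Qed.

Lemma measurable_fun_complex d (T : measurableType d) (f : T -> R[i]) :
  measurable_fun setT (re \o f) ->
  measurable_fun setT (im \o f) -> measurable_fun setT f.
Proof.
move=> mRe mIm _ _ [B mB <-]; rewrite !setTI -comp_preimage.
have mp : measurable_fun setT (complex_to_pair (R:=R) \o f).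
  exact: measurable_fun_pair mRe mIm.
by rewrite -[X in measurable X]setTI; exact: mp.
Qed.

Definition pair_to_complex (p : R * R) : R[i] := (p.1 +i* p.2)%C.

Lemma measurable_pair_to_complex : measurable_fun setT pair_to_complex.
Proof. by apply: measurable_fun_complex;
  [exact: measurable_fst|exact: measurable_snd]. Qed.

HB.instance Definition _ :=
  isMeasurableFun.Build _ _ _ _ pair_to_complex measurable_pair_to_complex.

Lemma measurable_funMC d (T : measurableType d) (f g : T -> R[i]) :
  measurable_fun setT f -> measurable_fun setT g ->
  measurable_fun setT (fun x => f x * g x).
Proof.
move=> mf mg.
have mRf := measurableT_comp measurable_fun_Re mf.
have mIf := measurableT_comp measurable_fun_Im mf.
have mRg := measurableT_comp measurable_fun_Re mg.
have mIg := measurableT_comp measurable_fun_Im mg.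
apply: measurable_fun_complex.
  rewrite (_ : _ \o _ = (re \o f) \* (re \o g) \-
                        (im \o f) \* (im \o g)); last first.
    by apply/funext => x /=; case: (f x) => a b; case: (g x) => a' b'.
  by apply: measurable_funB; exact: measurable_funM.
rewrite (_ : _ \o _ = (re \o f) \* (im \o g) \+
                      (im \o f) \* (re \o g)); last first.
  by apply/funext => x /=; case: (f x) => a b; case: (g x) => a' b' /=.
by apply: measurable_funD; exact: measurable_funM.
Qed.

Lemma measurable_funXC d (T : measurableType d) (f : T -> R[i]) n :
  measurable_fun setT f -> measurable_fun setT (fun x => f x ^+ n).
Proof.
move=> mf; elim: n => [|n IHn]; first by under eq_fun do rewrite expr0;
  exact: measurable_cst.
by under eq_fun do rewrite exprS; exact: measurable_funMC.
Qed.

Lemma measurable_funBC d (T : measurableType d) (f g : T -> R[i]) :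
  measurable_fun setT f -> measurable_fun setT g ->
  measurable_fun setT (fun x => f x - g x).
Proof.
move=> mf mg.
apply: measurable_fun_complex.
  rewrite (_ : _ \o _ = (re \o f) \- (re \o g)); last first.
    by apply/funext => x /=; case: (f x) => a b; case: (g x) => a' b'.
  by apply: measurable_funB; exact: measurableT_comp measurable_fun_Re _.
rewrite (_ : _ \o _ = (im \o f) \- (im \o g)); last first.
  by apply/funext => x /=; case: (f x) => a b; case: (g x) => a' b' /=.
by apply: measurable_funB; exact: measurableT_comp measurable_fun_Im _.
Qed.

Lemma measurable_sqrt : measurable_fun setT (@Num.sqrt R).
Proof. exact: continuous_measurable_fun (@sqrt_continuous R). Qed.

Lemma normc_sqrt (z : R[i]) :
  normc z = Num.sqrt (re z ^+ 2 + im z ^+ 2).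
Proof. by case: z. Qed.

Lemma normc_ge0 (z : R[i]) : 0 <= normc z.
Proof. by rewrite normc_sqrt sqrtr_ge0. Qed.

Lemma measurable_normc :
  measurable_fun setT (@ComplexField.Normc.normc R).
Proof.
rewrite (_ : @ComplexField.Normc.normc R = Num.sqrt \o
  (fun z => re z ^+ 2 + im z ^+ 2)); last first.
  by apply/funext => z; rewrite normc_sqrt.
apply: measurableT_comp measurable_sqrt _.
apply: measurable_funD; apply: measurable_funX.
- exact: measurable_fun_Re.
- exact: measurable_fun_Im.
Qed.

End complex_measurability.

(** * Lebesgue measure on the plane as a sigma-finite measure *)

Section lebesgueC_measure.
Context {R : realType}.
Local Open Scope ereal_scope.

Let lebesgueC0 : @lebesgueC R set0 = 0.
Proof. by rewrite /lebesgueC /pushforward preimage_set0 measure0. Qed.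

Let lebesgueC_ge0 A : 0 <= @lebesgueC R A.
Proof. by rewrite /lebesgueC /pushforward measure_ge0. Qed.

Let lebesgueC_sigma_additive : semi_sigma_additive (@lebesgueC R).
Proof.
pose mu : {measure set R[i] -> \bar R} :=
  measure_function_pushforward__canonical__measure_function_Measure
    (@lebesgue_measure R \x @lebesgue_measure R) measurable_pair_to_complex.
exact: (@measure_semi_sigma_additive _ _ _ mu).
Qed.

HB.instance Definition _ := isMeasure.Build _ _ _ (@lebesgueC R)
  lebesgueC0 lebesgueC_ge0 lebesgueC_sigma_additive.

Lemma lebesgueC_rect (A B : set R) : measurable A -> measurable B ->
  lebesgueC [set z | A (re z) /\ B (im z)] =
  lebesgue_measure A * lebesgue_measure B :> \bar R.
Proof. by move=> mA mB; rewrite -product_measure1E. Qed.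

Definition square (n : nat) : set R[i] :=
  [set z | `[- n%:R, n%:R]%classic (re z) /\
           `[- n%:R, n%:R]%classic (im z)]%R.

Lemma measurable_square n : measurable (square n).
Proof.
rewrite /square; exists (`[- n%:R, n%:R]%classic `*` `[- n%:R, n%:R]%classic)%R.
  exact: measurableX.
by rewrite setTI; apply/seteqP; split => -[].
Qed.

Lemma lebesgueC_square n : lebesgueC (square n) < +oo :> \bar R.
Proof.
rewrite lebesgueC_rect// !lebesgue_measure_itv/=.
by case: ifPn; rewrite ?mul0e// -EFinD -EFinM ltry.
Qed.

Lemma bigcup_square : \bigcup_n square n = setT.
Proof.
apply/seteqP; split => // z _ /=.
pose n := (Num.truncn (Num.max `|re z| `|im z|)%R).+1.
have : (Num.max `|re z| `|im z| < n%:R)%R by rewrite truncnS_gt.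
rewrite gt_max => /andP[zRe zIm].
by exists n => //; split; rewrite /= in_itv/= -ler_norml ltW.
Qed.

Let lebesgueC_sigma_finite : sigma_finite setT (@lebesgueC R).
Proof.
exists square; first by rewrite bigcup_square.
by move=> n; split; [exact: measurable_square|exact: lebesgueC_square].
Qed.

HB.instance Definition _ := Measure_isSigmaFinite.Build _ _ _ (@lebesgueC R)
  lebesgueC_sigma_finite.

Lemma ge0_integral_lebesgueC (f : R[i] -> \bar R) :
  measurable_fun setT f -> (forall z, 0 <= f z) ->
  \int[mC]_z f z =
  \int[leb]_x \int[leb]_y f (x +i* y)%C.
Proof.
move=> mf f0; rewrite ge0_integral_pushforward//=;
  last exact: measurable_pair_to_complex.
rewrite preimage_setT fubini_tonelli1//.
exact: measurableT_comp mf measurable_pair_to_complex.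
Qed.

Lemma ge0_integral_lebesgueC_swap (f : R[i] -> \bar R) :
  measurable_fun setT f -> (forall z, 0 <= f z) ->
  \int[mC]_z f z =
  \int[leb]_y \int[leb]_x f (x +i* y)%C.
Proof.
move=> mf f0; rewrite ge0_integral_lebesgueC//.
have mg : measurable_fun setT (f \o pair_to_complex).
  exact: measurableT_comp mf measurable_pair_to_complex.
by apply: (@fubini_tonelli _ _ _ _ _ leb leb (f \o pair_to_complex)) => // x;
  exact: f0.
Qed.

End lebesgueC_measure.

(** * Affine substitutions on the line and multiplication by a complex number *)

Section affine_change_of_variable.
Context {R : realType}.
Local Open Scope ereal_scope.

(** Both sides are measures in [A], so it suffices to compare them on half-open intervals. *)
Lemma lebesgue_measure_affine (a b : R) (A : set R) : a != 0%R ->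
  measurable A ->
  lebesgue_measure A = `|a|%:E * lebesgue_measure
    ((fun x => a * x + b)%R @^-1` A).
Proof.
move=> a0 mA.
pose g (x : R) : measurableTypeR R := (a * x + b)%R.
have mg : measurable_fun setT g.
  apply: measurable_funD; last exact: measurable_cst.
  exact: measurable_funM (measurable_cst _) (@measurable_id _ _ _).
pose mu : {measure set (measurableTypeR R) -> \bar R} :=
  measure_function_pushforward__canonical__measure_function_Measure
    (@lebesgue_measure R) mg.
rewrite -[RHS]/(mscale (NngNum (normr_ge0 a)) mu A).
apply: lebesgue_measure_unique => // _ [[u v] _ <-] /=.
rewrite /mscale/= /pushforward lebesgue_measure_itv/=.
case: (ltgtP a 0%R) a0 => // a0 _.
  (* For negative [a] the preimage of an interval closed on the right is closed on the left; its
     length is given by the same formula. *)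
  rewrite (_ : g @^-1` _ = `[((v - b) / a)%R, ((u - b) / a)%R[%classic);
    last first.
    apply/seteqP; split => x /=; rewrite /g !in_itv/= ler_ndivrMr//
      ltr_ndivlMr//;
    by rewrite lerBrDr ltrBlDr mulrC andbC.
  rewrite lebesgue_measure_itv/= !lte_fin ltr_nM2r ?invr_lt0// ltrD2r.
  case: ifPn => _; last by rewrite mule0.
  rewrite -!EFinB -EFinM; congr (_%:E).
  by rewrite ltr0_norm//; field; rewrite lt_eqF.
rewrite (_ : g @^-1` _ = `]((u - b) / a)%R, ((v - b) / a)%R]%classic);
  last first.
  apply/seteqP; split => x /=; rewrite /g !in_itv/= ler_pdivlMr// ltr_pdivrMr//;
  by rewrite lerBrDr ltrBlDr mulrC.
rewrite lebesgue_measure_itv/= !lte_fin ltr_pM2r ?invr_gt0// ltrD2r.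
case: ifPn => _; last by rewrite mule0.
rewrite -!EFinB -EFinM; congr (_%:E).
by rewrite gtr0_norm//; field; rewrite gt_eqF.
Qed.

Lemma ge0_integral_affine (a b : R) (f : R -> \bar R) : a != 0%R ->
  measurable_fun setT f -> (forall x, 0 <= f x) ->
  \int[leb]_x f x = `|a|%:E * \int[leb]_x f (a * x + b)%R.
Proof.
move=> a0 mf f0.
pose g (x : R) : measurableTypeR R := (a * x + b)%R.
have mg : measurable_fun setT g.
  apply: measurable_funD; last exact: measurable_cst.
  exact: measurable_funM (measurable_cst _) (@measurable_id _ _ _).
pose mu : {measure set (measurableTypeR R) -> \bar R} :=
  measure_function_pushforward__canonical__measure_function_Measure
    (@lebesgue_measure R) mg.
rewrite (eq_measure_integral (mscale (NngNum (normr_ge0 a)) mu)); last first.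
  by move=> A mA _; exact: lebesgue_measure_affine.
rewrite ge0_integral_mscale//; congr (_ * _).
by rewrite ge0_integral_pushforward// preimage_setT.
Qed.

Lemma measurable_fun_mulC (c : R[i]) : measurable_fun setT (fun z => c * z)%R.
Proof. by apply: measurable_funMC;
  [exact: measurable_cst|exact: measurable_id]. Qed.

(* For [c = a + ib] with [a != 0], substitute [x := a x - b y] at fixed [y],
   then [y := b / a x + |c|^2 / a y] at fixed [x]. *)
Let ge0_integral_mulC_Re (c : R[i]) (f : R[i] -> \bar R) : re c != 0%R ->
  measurable_fun setT f -> (forall z, 0 <= f z) ->
  \int[mC]_z f z = (normc c ^+ 2)%:E * \int[mC]_z f (c * z)%R.
Proof.
case: c => a b /= a0 mf f0.
have ab0 : (0 < a ^+ 2 + b ^+ 2)%R.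
  by rewrite ltr_pwDl ?sqr_ge0// exprn_even_gt0.
have mfxy : measurable_fun setT (f \o pair_to_complex).
  exact: measurableT_comp mf measurable_pair_to_complex.
have mfc := measurableT_comp mf (measurable_fun_mulC (a +i* b)%C).
have mrow (x : R) : measurable_fun setT (fun y => f (x +i* y)%C).
  exact: (measurableT_comp mfxy (measurable_pair1 x)).
pose c' := ((a ^+ 2 + b ^+ 2) / a)%R.
have c'0 : c' != 0%R by rewrite mulf_neq0 ?invr_eq0// gt_eqF.
rewrite sqr_sqrtr ?ltW// ge0_integral_lebesgueC// ge0_integral_lebesgueC_swap//.
pose F (p : R * R) := f (p.1 +i* (c' * p.2 + b / a * p.1)%R)%C.
have mF : measurable_fun setT F.
  apply: (measurableT_comp mf); apply: measurable_fun_complex => /=;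
    first exact: measurable_fst.
  by apply: measurable_funD; apply: measurable_funM.
have F0 p : 0 <= F p by exact: f0.
transitivity (\int[leb]_x (`|c'|%:E * fubini_F leb F x)).
  apply: eq_integral => x _.
  exact: (@ge0_integral_affine c' (b / a * x)%R (fun y => f (x +i* y)%C)).
transitivity (`|c'|%:E * \int[leb]_x fubini_F leb F x).
  apply: ge0_integralZl => //; first exact: measurable_fun_fubini_tonelli_F.
  by move=> x _; exact: integral_ge0.
transitivity (`|c'|%:E * \int[leb]_y fubini_G leb F y).
  by congr (_ * _); exact: fubini_tonelli.
pose G (p : R * R) := F (a * p.1 + - b * p.2, p.2)%R.
have mG : measurable_fun setT G.
  apply: (measurableT_comp mF); apply: measurable_fun_pair => //=.
  by apply: measurable_funD; apply: measurable_funM.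
have G0 p : 0 <= G p by exact: F0.
transitivity (`|c'|%:E * \int[leb]_y (`|a|%:E * fubini_G leb G y)).
  congr (_ * _); apply: eq_integral => y _.
  apply: (@ge0_integral_affine a (- b * y)%R (fun x => F (x, y))) => //.
  exact: (measurableT_comp mF (measurable_pair2 y)).
transitivity (`|c'|%:E * (`|a|%:E * \int[leb]_y fubini_G leb G y)).
  congr (_ * _); apply: ge0_integralZl => //;
    first exact: measurable_fun_fubini_tonelli_G.
  by move=> y _; exact: integral_ge0.
have cE X : `|c'|%:E * (`|a|%:E * X) = (a ^+ 2 + b ^+ 2)%:E * X.
  by rewrite muleA -EFinM -normrM mulfVK// gtr0_norm.
rewrite cE; congr (_ * _).
apply: eq_integral => y _; apply: eq_integral => x _; rewrite /G /F /=; congr f.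
by congr (_ +i* _)%C; rewrite /c'; field.
Qed.

Lemma ge0_integral_mulC (c : R[i]) (f : R[i] -> \bar R) : c != 0%R ->
  measurable_fun setT f -> (forall z, 0 <= f z) ->
  \int[mC]_z f z = (normc c ^+ 2)%:E * \int[mC]_z f (c * z)%R.
Proof.
move=> c0 mf f0; have [Rc0|] := eqVneq (re c) 0%R; last first.
  by move=> ?; exact: ge0_integral_mulC_Re.
(* A purely imaginary [c] is the product of [c / d] and [d], both of which have nonzero real
   part. *)
pose d : R[i] := (1%R +i* 1%R)%C.
have d0 : d != 0%R by rewrite eq_complex/= oner_eq0.
have cd0 : re (c / d)%R != 0%R.
  case: c Rc0 c0 => a b /= ->; rewrite eq_complex/= eqxx/= => b0.
  by rewrite mul0r sub0r mulrN opprK !expr1n mulf_neq0// mul1r invr_eq0 -mulr2n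
    pnatr_eq0.
rewrite (@ge0_integral_mulC_Re (c / d)%R f)//.
rewrite (@ge0_integral_mulC_Re d (fun z => f (c / d * z)%R)) ?oner_eq0//;
  last first.
  exact: measurableT_comp mf (measurable_fun_mulC _).
rewrite muleA -EFinM -exprMn -ComplexField.Normc.normcM mulfVK//; congr (_ * _).
by apply: eq_integral => z _; rewrite mulrA mulfVK.
Qed.

End affine_change_of_variable.

(** * Change of variable [w = z ^+ M] *)

Section power_change_of_variable.
Context {R : realType}.
Local Open Scope ereal_scope.
Implicit Types f g : R[i] -> \bar R.

Lemma normcX (z : R[i]) n : normc (z ^+ n)%R = (normc z ^+ n)%R.
Proof.
elim: n => [|n IHn]; first by rewrite !expr0 ComplexField.Normc.normc1.
by rewrite !exprS ComplexField.Normc.normcM IHn.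
Qed.

Lemma normc0 : normc (0%R : R[i]) = 0%R.
Proof. by rewrite normc_sqrt /= expr0n addr0 sqrtr0. Qed.

Lemma normc_eq0 (z : R[i]) : (normc z == 0)%R = (z == 0%R).
Proof.
apply/eqP/eqP => [/ComplexField.Normc.eq0_normc//|->]. exact: normc0.
Qed.

Lemma measurable_fun_invC : measurable_fun setT (fun z : R[i] => z^-1)%R.
Proof.
have mn : measurable_fun setT (fun z : R[i] => (normc z ^+ 2)^-1)%R.
  rewrite (_ : (fun z => _) = (fun z : R[i] => powR (normc z ^+ 2) (-1)))%R;
    last first.
    by apply/funext => z; rewrite powR_inv1// exprn_ge0// normc_ge0.
  apply: (measurableT_comp (measurable_powR (-1))).
  by apply: measurable_funX; exact: measurable_normc.
have e (z : R[i]) : (normc z ^+ 2 = re z ^+ 2 + im z ^+ 2)%R.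
  by rewrite normc_sqrt sqr_sqrtr// addr_ge0 ?sqr_ge0.
apply: measurable_fun_complex.
  rewrite (_ : _ \o _ = (re \* (fun z : R[i] => (normc z ^+ 2)^-1))%R).
    by apply: measurable_funM => //; exact: measurable_fun_Re.
  by apply/funext => z /=; rewrite e; case: z.
rewrite (_ : _ \o _ = ((\- im) \* (fun z : R[i] => (normc z ^+ 2)^-1))%R).
  apply: measurable_funM => //; apply: measurable_funN;
    exact: measurable_fun_Im.
by apply/funext => z /=; rewrite e; case: z => a b /=; rewrite mulNr.
Qed.

(* The density of the Haar measure of the multiplicative group; it vanishes at
   [0] since [0^-1 = 0]. *)
Definition haar_weight (z : R[i]) : \bar R := ((normc z ^+ 2)^-1)%:E.

Lemma haar_weight_ge0 z : 0 <= haar_weight z.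
Proof. by rewrite lee_fin invr_ge0 exprn_ge0// normc_ge0. Qed.

Lemma haar_weight0 : haar_weight 0%R = 0.
Proof. by rewrite /haar_weight [normc _]normc0 expr0n invr0. Qed.

Lemma measurable_haar_weight : measurable_fun setT haar_weight.
Proof.
apply/measurable_EFinP.
rewrite (_ : (fun z => _) = (fun z : R[i] => normc (z^-1) ^+ 2))%R; last first.
  by apply/funext => z; rewrite ComplexField.Normc.normcV exprVn.
apply: measurable_funX; exact: measurableT_comp measurable_normc
  measurable_fun_invC.
Qed.

(** The Jacobian [normc c ^+ 2] of the multiplication by [c] cancels against the weight. *)
Lemma haar_invariance (c : R[i]) f : c != 0%R ->
  measurable_fun setT f -> (forall z, 0 <= f z) ->
  \int[mC]_z (f (c * z)%R * haar_weight z) = \int[mC]_z (f z * haar_weight z).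
Proof.
move=> c0 mf f0.
have mfh : measurable_fun setT (fun z => f z * haar_weight z).
  by apply: emeasurable_funM => //; exact: measurable_haar_weight.
have fh0 z : 0 <= f z * haar_weight z by rewrite mule_ge0// haar_weight_ge0.
rewrite [RHS](@ge0_integral_mulC _ c)//.
have nc0 : (0 < normc c ^+ 2)%R by rewrite exprn_gt0// lt_neqAle eq_sym
  normc_eq0 c0 normc_ge0.
rewrite -[RHS]ge0_integralZl//; last 2 first.
- exact: (measurableT_comp mfh (measurable_fun_mulC c)).
- by rewrite lee_fin ltW.
apply: eq_integral => z _; rewrite muleCA; congr (_ * _).
rewrite /haar_weight ComplexField.Normc.normcM exprMn [in RHS]invfM -EFinM
  mulVKf//.
by rewrite gt_eqF.
Qed.

Variable M : nat.
Hypothesis M0 : (0 < M)%N.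

(** The integral of [f] against the image of the Haar measure under [z |-> z ^+ M]. *)
Definition haar_power f := \int[mC]_z (f (z ^+ M)%R * haar_weight z).

Lemma measurable_funXM : measurable_fun setT (fun z : R[i] => z ^+ M)%R.
Proof. by apply: measurable_funXC; exact: measurable_id. Qed.

(* This is the uniqueness argument for Haar measures, applied to the Haar
   measure of the multiplicative group and its image under [z |-> z ^+ M]. *)
Lemma haar_power_unique f g :
  measurable_fun setT f -> (forall z, 0 <= f z) ->
  measurable_fun setT g -> (forall z, 0 <= g z) ->
  haar_power f * \int[mC]_z (g z * haar_weight z) =
  haar_power g * \int[mC]_z (f (z^-1)%R * haar_weight z).
Proof.
move=> mf f0 mg g0.
have mh := @measurable_haar_weight.
have h0 := haar_weight_ge0.
have mfM := measurableT_comp mf measurable_funXM.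
have mgM := measurableT_comp mg measurable_funXM.
pose A (p : R[i] * R[i]) := f (p.1 ^+ M)%R * haar_weight p.1 *
  (g (p.1 ^+ M * p.2)%R * haar_weight p.2).
pose B (p : R[i] * R[i]) := g (p.1 ^+ M)%R * haar_weight p.1 *
  (f (p.1 ^+ M / p.2)%R * haar_weight p.2).
have mX1 : measurable_fun setT (fun p : R[i] * R[i] => p.1 ^+ M)%R by exact:
  measurable_funXC.
have mh1 : measurable_fun setT (fun p : R[i] * R[i] => haar_weight p.1) by
  exact: measurableT_comp.
have mh2 : measurable_fun setT (fun p : R[i] * R[i] => haar_weight p.2) by
  exact: measurableT_comp.
have mA : measurable_fun setT A.
  apply: emeasurable_funM; apply: emeasurable_funM => //.
    exact: (measurableT_comp mf).
  by apply: (measurableT_comp mg); exact: measurable_funMC.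
have mB : measurable_fun setT B.
  apply: emeasurable_funM; apply: emeasurable_funM => //.
    exact: (measurableT_comp mg).
  apply: (measurableT_comp mf); apply: measurable_funMC => //.
  exact: measurableT_comp measurable_fun_invC measurable_snd.
have A0 p : 0 <= A p by rewrite !mule_ge0.
have B0 p : 0 <= B p by rewrite !mule_ge0.
have mgs (c : R[i]) : measurable_fun setT (fun z : R[i] => g (c * z)%R).
  exact: measurableT_comp mg (measurable_fun_mulC c).
have mfs (c : R[i]) : measurable_fun setT (fun z : R[i] => f (c / z)%R).
  by apply: (measurableT_comp mf (measurableT_comp (measurable_fun_mulC c)
    measurable_fun_invC)).
have fac (a : \bar R) (k : R[i] -> \bar R) : 0 <= a -> measurable_fun setT k ->
    (forall z, 0 <= k z) -> \int[mC]_z (a * k z) = a * \int[mC]_z k z.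
  by move=> a0 mk k0; exact: ge0_integralZl.
(* Invariance lets [x ^+ M] be inserted in the argument of [g], which couples the two variables. *)
transitivity (\int[mC]_x fubini_F mC A x).
  rewrite /haar_power -ge0_integralZr//; last 3 first.
  - by apply: emeasurable_funM.
  - by move=> z _; rewrite mule_ge0.
  - by apply: integral_ge0 => z _; rewrite mule_ge0.
  apply: eq_integral => x _; rewrite /fubini_F /A /=.
  rewrite [RHS](@fac _ (fun y => g (x ^+ M * y)%R * haar_weight y));
    last 3 first.
  - by rewrite mule_ge0.
  - by apply: emeasurable_funM.
  - by move=> z; rewrite mule_ge0.
  have [->|x0] := eqVneq x 0%R; first by rewrite haar_weight0 mule0 !mul0e.
  by congr (_ * _); rewrite haar_invariance// expf_neq0.
transitivity (\int[mC]_y fubini_G mC A y); first exact: fubini_tonelli.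
transitivity (\int[mC]_y fubini_G mC B y).
  apply: eq_integral => y _; rewrite /fubini_G /A /B /=.
  have [->|y0] := eqVneq y 0%R.
    by apply: eq_integral => x _; rewrite haar_weight0 !mule0.
  (* Replacing [x] by [d * x] turns [f (x ^+ M)] into [f (x ^+ M / y)] and [g (x ^+ M * y)] into
     [g (x ^+ M)]. That every [y] has an [M]-th root is what makes the image measure invariant. *)
  pose d := (M.-root (y^-1))%R.
  have dM : (d ^+ M = y^-1)%R by rewrite rootCK.
  have d0 : d != 0%R by apply: contra_neq y0 => d0;
    rewrite -[y]invrK -dM d0 expr0n gtn_eqF// invr0.
  transitivity (\int[mC]_x ((f (x ^+ M)%R * (g (x ^+ M * y)%R * haar_weight y))
    * haar_weight x)).
    by apply: eq_integral => x _; rewrite muleAC.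
  rewrite -(@haar_invariance d)//; last 2 first.
  - apply: emeasurable_funM => //; apply: emeasurable_funM => //.
    apply: (measurableT_comp mg); apply: measurable_funMC => //.
    exact: measurable_funXM.
  - by move=> x; rewrite !mule_ge0.
  apply: eq_integral => x _; rewrite exprMn dM mulrAC mulVf// mul1r.
  by rewrite [(y^-1 * _)%R]mulrC muleCA muleAC.
transitivity (\int[mC]_x fubini_F mC B x); first by apply/esym;
  exact: fubini_tonelli.
rewrite /haar_power -[RHS]ge0_integralZr//; last 3 first.
- by apply: emeasurable_funM.
- by move=> z _; rewrite mule_ge0.
- by apply: integral_ge0 => z _; rewrite mule_ge0.
apply: eq_integral => x _; rewrite /fubini_F /B /=.
rewrite [LHS](@fac _ (fun y => f (x ^+ M / y)%R * haar_weight y)); last 3 first.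
- by rewrite mule_ge0.
- by apply: emeasurable_funM.
- by move=> z; rewrite mule_ge0.
have [->|x0] := eqVneq x 0%R; first by rewrite haar_weight0 mule0 !mul0e.
(* Replacing [y] by [x ^+ M * y] removes [x] from the argument of [f] and decouples the variables
   again. *)
congr (_ * _); rewrite -(@haar_invariance (x ^+ M)%R)//; last exact: expf_neq0.
apply: eq_integral => z _; rewrite invfM mulrA divff ?mul1r//.
exact: expf_neq0.
Qed.

End power_change_of_variable.

(** * The constant in the change of variable, from the Haar mass of annuli *)

Section power_change_of_variable_constant.
Context {R : realType}.
Local Open Scope ereal_scope.
Implicit Types f g : R[i] -> \bar R.

Definition annulus (r : R) : set R[i] := [set z | 1 <= normc z < r]%R.

Lemma measurable_annulus r : measurable (annulus r).
Proof.
rewrite (_ : annulus r = setT `&`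
  (@ComplexField.Normc.normc R @^-1` `[1%R, r[%classic)); last first.
  by rewrite setTI; apply/seteqP; split => z /=; rewrite in_itv.
by apply: measurable_normc => //; exact: measurable_itv.
Qed.

Definition haar_annulus (r : R) : \bar R :=
  \int[mC]_z ((\1_(annulus r) z)%:E * haar_weight z).

Let measurable_indicC (A : set R[i]) : measurable A ->
  measurable_fun setT (fun z => (\1_A z)%:E : \bar R).
Proof. by move=> mA; apply/measurable_EFinP; exact: measurable_indic. Qed.

(** The annulus of outer radius [r ^+ n.+1] is the disjoint union of the one of outer radius [r] and
    of the dilate by [r] of the one of outer radius [r ^+ n]. Dilations preserve Haar measure. *)
Lemma haar_annulusX n (r : R) : (1 <= r)%R ->
  haar_annulus (r ^+ n)%R = n%:R%:E * haar_annulus r.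
Proof.
move=> r1; have r0 : (0 < r)%R by exact: lt_le_trans r1.
have mh := @measurable_haar_weight R; have h0 := @haar_weight_ge0 R.
have nr : normc (real_complex R r) = r.
  by rewrite normc_sqrt /= expr0n addr0 sqrtr_sqr gtr0_norm.
elim: n => [|n IHn].
  rewrite mul0e /haar_annulus integral0_eq// => z _.
  by rewrite indicE memNset ?mul0e// /annulus/= expr0 =>
    /andP[/le_lt_trans /[apply]]; rewrite ltxx.
pose f z : \bar R := (\1_(annulus (r ^+ n)%R) ((real_complex R r)^-1 * z)%R)%:E.
have mf : measurable_fun setT f.
  apply: (measurableT_comp (f := fun z => (\1_(annulus (r ^+ n)%R) z)%:E)).
    exact: measurable_indicC (measurable_annulus _).
  exact: measurable_fun_mulC.
have f0 z : 0 <= f z by rewrite lee_fin.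
have fE z : (\1_(annulus (r ^+ n.+1)%R) z)%:E = (\1_(annulus r) z)%:E + f z.
  rewrite /f !indicE -EFinD -natrD; congr (_%:R%:E).
  have e b1 b2 b3 : b1 = b2 (+) b3 -> ~~ (b2 && b3) -> (b1 : nat) = (b2 + b3)%N.
    by case: b1; case: b2; case: b3.
  have inE' s (w : R[i]) : (w \in annulus s) = (1 <= normc w < s)%R.
    by apply/idP/idP => [/set_mem//|?]; exact/mem_set.
  apply: e; rewrite !inE' ComplexField.Normc.normcM ComplexField.Normc.normcV
    nr.
    rewrite ler_pdivlMl// ltr_pdivrMl// mulr1 -exprS.
    have [zr|zr] := leP r (normc z); first by rewrite (le_trans r1 zr) andbF.
    rewrite (lt_le_trans zr) ?addbF// -[leLHS]mulr1 exprS ler_wpM2l ?(ltW r0)//.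
    exact: exprn_ege1.
  rewrite ler_pdivlMl// mulr1.
  by have [zr|zr] := leP r (normc z); rewrite ?andbF.
transitivity (\int[mC]_z ((\1_(annulus r) z)%:E * haar_weight z + f z *
  haar_weight z)).
  by apply: eq_integral => z _; rewrite fE muleDl.
rewrite ge0_integralD//; last 4 first.
- by move=> z _; rewrite mule_ge0// lee_fin.
- by apply: emeasurable_funM => //;
    exact: measurable_indicC (measurable_annulus _).
- by move=> z _; rewrite mule_ge0.
- exact: emeasurable_funM.
rewrite -(@haar_invariance _ (real_complex R r) f)//; last first.
  by rewrite -normc_eq0 nr gt_eqF.
rewrite -natr1 EFinD ge0_muleDl ?lee_fin// mul1e addeC -IHn; congr (_ + _).
apply: eq_integral => z _; rewrite /f mulrA mulVf ?mul1r//.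
by rewrite -normc_eq0 nr gt_eqF.
Qed.

(** On this annulus the weight is at most 1, and the annulus lies in a square of finite measure. *)
Lemma haar_annulus_fin : haar_annulus 2%R < +oo.
Proof.
apply: (@le_lt_trans _ _ (\int[mC]_z (\1_(square 2%N) z)%:E)); last first.
  by rewrite integral_indic//= ?setIT ?lebesgueC_square//;
    exact: measurable_square.
apply: ge0_le_integral => //.
- by move=> z _; rewrite mule_ge0// haar_weight_ge0.
- apply: emeasurable_funM; last exact: measurable_haar_weight.
  exact: measurable_indicC (measurable_annulus _).
- exact: measurable_indicC (measurable_square _).
move=> z _; rewrite !indicE.
have [/set_mem/= /andP[z1 z2]|_] := boolP (z \in annulus 2%R); last first.
  by rewrite mul0e.
rewrite mul1e mem_set.
  rewrite lee_fin invf_le1 ?exprn_ege1// exprn_gt0//; exact: lt_le_trans z1.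
have zE : (re z ^+ 2 + im z ^+ 2 = normc z ^+ 2)%R.
  by rewrite normc_sqrt sqr_sqrtr// addr_ge0// sqr_ge0.
have z4 : (normc z ^+ 2 <= 2 ^+ 2)%R by rewrite ler_pXn2r ?nnegrE ?normc_ge0//
  ltW.
by split; rewrite /= in_itv/= -ler_norml -(@ler_pXn2r _ 2)// ?nnegrE//
  real_normK ?num_real//;
  rewrite (le_trans _ z4)// -zE ?lerDl ?lerDr sqr_ge0.
Qed.

Lemma haar_annulus_gt0 : 0 < haar_annulus 2%R.
Proof.
(* This rectangle lies in the annulus because [(3/2)^2 + 1 < 4], and the weight on it is at least
   [1/4]. *)
pose A : set R[i] := [set z | `[1%R, (3/2)%R]%classic (re z) /\
  `[0%R, 1%R]%classic (im z)].
have mA : measurable A.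
  exists (`[1%R, (3/2)%R]%classic `*` `[0%R, 1%R]%classic);
    first exact: measurableX.
  by rewrite setTI; apply/seteqP; split => -[].
apply: (@lt_le_trans _ _ (\int[mC]_z ((4^-1)%:E * (\1_A z)%:E))).
  rewrite ge0_integralZl ?lee_fin ?invr_ge0//; last exact: measurable_indicC.
  rewrite integral_indic//= setIT lebesgueC_rect// !lebesgue_measure_itv/=
    !lte_fin.
  rewrite ltr01 (_ : (1 < 3 / 2)%R); last by lra.
  by rewrite -!EFinB -!EFinM lte_fin; lra.
apply: ge0_le_integral => //.
- by apply: emeasurable_funM => //; exact: measurable_indicC.
- apply: emeasurable_funM; last exact: measurable_haar_weight.
  exact: measurable_indicC (measurable_annulus _).
move=> z _; rewrite !indicE.
have [/set_mem[]|_] := boolP (z \in A);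
  last by rewrite mule0 mule_ge0// haar_weight_ge0.
rewrite /= !in_itv/= => /andP[x1 x2] /andP[y1 y2].
have zE : (re z ^+ 2 + im z ^+ 2 = normc z ^+ 2)%R.
  by rewrite normc_sqrt sqr_sqrtr// addr_ge0// sqr_ge0.
have z1 : (1 <= normc z)%R.
  by rewrite -(@expr_ge1 _ 2) ?normc_ge0// -zE; nra.
have z4 : (normc z ^+ 2 < 4)%R by rewrite -zE; nra.
have z2 : (normc z < 2)%R.
  by rewrite -(@ltr_pXn2r _ 2) ?nnegrE ?normc_ge0// (lt_le_trans z4)//; lra.
rewrite mem_set ?mule1 ?mul1e ?lee_fin//; last by rewrite /annulus/= z1 z2.
rewrite lef_pV2 ?posrE// ?(ltW z4)// exprn_gt0//.
exact: lt_le_trans z1.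
Qed.

Lemma lebesgueC_set1_0 : lebesgueC [set (0%R : R[i])] = 0.
Proof.
rewrite (_ : [set _] = [set z | [set 0%R] (re z) /\ [set 0%R] (im z)]).
  by rewrite lebesgueC_rect// lebesgue_measure_set1 mul0e.
by apply/seteqP; split => [z -> //|[a b] [/= -> ->]].
Qed.

Lemma measurable_complex0 : measurable [set (0%R : R[i])].
Proof.
exists ([set 0%R] `*` [set 0%R]); first exact: measurableX.
by rewrite setTI; apply/seteqP; split => [[a b] [/= -> ->] //|_ ->].
Qed.

Lemma ae_lebesgueC_neq0 : {ae (@lebesgueC R), forall z : R[i], z != 0%R}.
Proof.
exists [set 0%R]; split.
- exact: measurable_complex0.
- exact: lebesgueC_set1_0.
- by move=> z /= /negP; rewrite negbK => /eqP.
Qed.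

Variable M : nat.
Hypothesis M0 : (0 < M)%N.

(** The uniqueness lemma is tested on the indicator of the annulus of outer radius [2 ^+ M], whose
    preimage under the power map is the annulus of outer radius 2; [haar_annulusX] compares the two
    masses. *)
Lemma haar_powerE g : measurable_fun setT g -> (forall z, 0 <= g z) ->
  \int[mC]_z (g z * haar_weight z) = M%:R%:E * haar_power M g.
Proof.
move=> mg g0.
pose f z : \bar R := (\1_(annulus (2 ^+ M)%R) z)%:E.
have mf : measurable_fun setT f by exact: measurable_indicC
  (measurable_annulus _).
have f0 z : 0 <= f z by rewrite lee_fin.
have Nf : haar_power M f = haar_annulus 2%R.
  apply: eq_integral => z _; congr (_ * _); congr (_%:E).
  rewrite !indicE; congr ((_ : bool)%:R).
  have inE' s (w : R[i]) : (w \in annulus s) = (1 <= normc w < s)%R.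
    by apply/idP/idP => [/set_mem//|?]; exact/mem_set.
  by rewrite !inE' normcX expr_ge1 ?normc_ge0// ltr_pXn2r ?nnegrE ?normc_ge0.
have Nff : haar_annulus 2%R \is a fin_num.
  by rewrite ge0_fin_numE ?haar_annulus_fin// ltW// haar_annulus_gt0.
have cancel (a b : \bar R) : haar_annulus 2%R * a = haar_annulus 2%R * b ->
  a = b.
  have [r [r0 ->]] : exists r, (0 < r)%R /\ haar_annulus 2%R = r%:E.
    exists (fine (haar_annulus 2%R)); rewrite fineK//; split=> //.
    by rewrite fine_gt0// haar_annulus_gt0 haar_annulus_fin.
  move=> e; rewrite -[a]mul1e -[b]mul1e -(mulVf (lt0r_neq0 r0)) EFinM -!muleA.
  by rewrite e.
(* Taking the same [f] on both sides shows that [f] and its composition with the inverse have the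
   same Haar integral. *)
have fV := haar_power_unique M0 mf f0 mf f0.
rewrite Nf in fV; move/cancel in fV.
apply: cancel; rewrite -{1}Nf haar_power_unique// -fV.
rewrite -[X in _ * X]/(haar_annulus (2 ^+ M)%R) haar_annulusX ?ler1n//.
by rewrite muleC -!muleA muleCA.
Qed.

(* [w = z ^+ M] is an [M]-to-one map with Jacobian [M ^ 2 |z| ^ (2 (M - 1))]. *)
Lemma ge0_integral_powC f : measurable_fun setT f -> (forall z, 0 <= f z) ->
  \int[mC]_z (f (z ^+ M)%R * (M%:R * normc z ^+ (2 * (M - 1))%N)%:E) =
  \int[mC]_z f z.
Proof.
move=> mf f0.
have mh := @measurable_haar_weight R; have h0 := @haar_weight_ge0 R.
have mn n : measurable_fun setT (fun z : R[i] => (normc z ^+ n)%:E : \bar R).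
  by apply/measurable_EFinP; apply: measurable_funX; exact: measurable_normc.
have n0 n (z : R[i]) : 0 <= (normc z ^+ n)%:E by rewrite lee_fin exprn_ge0//
  normc_ge0.
have mfM := measurableT_comp mf (@measurable_funXM R M).
(* Away from the null set of 0, the factor [normc z ^+ 2] undoes the Haar weight. At [z ^+ M] it
   becomes [normc z ^+ (2 * M)], and the weight lowers the exponent to that of the Jacobian. *)
pose g z := f z * (normc z ^+ 2)%:E.
have g0 z : 0 <= g z by rewrite mule_ge0.
have mg : measurable_fun setT g by exact: emeasurable_funM.
have mgM := measurableT_comp mg (@measurable_funXM R M).
transitivity (\int[mC]_z (g z * haar_weight z)).
  rewrite haar_powerE// /haar_power -ge0_integralZl//; last 2 first.
  - exact: emeasurable_funM.
  - by move=> z _; rewrite mule_ge0.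
  apply: ge0_ae_eq_integral => //.
  - apply: emeasurable_funM => //; under eq_fun do rewrite EFinM.
    by apply: emeasurable_funM.
  - by apply: emeasurable_funM => //; exact: emeasurable_funM.
  - by move=> z _; rewrite mule_ge0// lee_fin mulr_ge0// exprn_ge0// normc_ge0.
  - by move=> z _; rewrite !mule_ge0// lee_fin.
  apply: filterS ae_lebesgueC_neq0 => z z0 _.
  rewrite /g /haar_weight -!muleA [RHS]muleCA; congr (_ * _).
  rewrite -!EFinM; congr (_ * _)%:E; rewrite normcX.
  have nz0 : normc z != 0%R by rewrite normc_eq0.
  apply: (mulIf (expf_neq0 2 nz0)); rewrite mulfVK ?expf_neq0//.
  by rewrite -exprM -exprD -mulnSr subn1 prednK// mulnC.
apply: ge0_ae_eq_integral => //.
- exact: emeasurable_funM.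
- by move=> z _; rewrite mule_ge0.
apply: filterS ae_lebesgueC_neq0 => z z0 _.
rewrite /g /haar_weight -muleA -EFinM divff ?mule1//.
by rewrite expf_neq0// normc_eq0.
Qed.

End power_change_of_variable_constant.

(** * Lebesgue measure on tuples *)

Section lebesgueCn_measure.
Context {R : realType}.
Local Open Scope ereal_scope.

Definition tuple_cons n (p : R[i] * n.-tuple R[i]) : n.+1.-tuple R[i] :=
  [tuple of p.1 :: p.2].

Definition tuple_uncons n (z : n.+1.-tuple R[i]) : R[i] * n.-tuple R[i] :=
  (thead z, [tuple of behead z]).

Lemma tuple_unconsK n : cancel (@tuple_cons n) (@tuple_uncons n).
Proof. by case=> x s; congr (_, _); apply: val_inj. Qed.

Lemma measurable_tuple_cons n : measurable_fun setT (@tuple_cons n).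
Proof. by apply: measurable_cons;
  [exact: measurable_fst|exact: measurable_snd]. Qed.

Lemma measurable_tuple_uncons n : measurable_fun setT (@tuple_uncons n).
Proof.
by apply: measurable_fun_pair; [exact: measurable_tnth|exact:
  measurable_behead].
Qed.

(** Being a measure and being sigma-finite go through the induction together: the product with
    [lebesgueC] is a measure because the lower-dimensional factor is sigma-finite. The instances
    below are transported from this witness. *)
Lemma lebesgueCn_sigma_finite_measure n :
  {mu : {sigma_finite_measure set (n.-tuple R[i]) -> \bar R} |
    @lebesgueCn R n = mu :> (set (n.-tuple R[i]) -> \bar R)}.
Proof.
elim: n => [|n [mu muE]].
  pose mu0 : {sigma_finite_measure set (0.-tuple R[i]) -> \bar R} :=
    dirac ([tuple] : 0.-tuple R[i]).
  by exists mu0.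
pose mu' : {measure set (n.+1.-tuple R[i]) -> \bar R} :=
  measure_function_pushforward__canonical__measure_function_Measure
    (@lebesgueC R \x mu) (@measurable_tuple_cons n).
have sf : sigma_finite setT mu'.
  have /sigma_finiteP[F [TF ndF Foo]] := sigma_finiteT (@lebesgueC R).
  have /sigma_finiteP[G [TG ndG Goo]] := sigma_finiteT mu.
  exists (fun k => @tuple_uncons n @^-1` (F k `*` G k)).
    apply/seteqP; split => // z _.
    have [i _ Fi] : (\bigcup_i F i) (thead z) by rewrite -TF.
    have [j _ Gj] : (\bigcup_i G i) [tuple of behead z] by rewrite -TG.
    exists (maxn i j) => //; split.
    - by have /subsetPset := ndF _ _ (leq_maxl i j); exact.
    - by have /subsetPset := ndG _ _ (leq_maxr i j); exact.
  move=> k; have [mF Fk] := Foo k; have [mG Gk] := Goo k; split.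
    rewrite -[X in measurable X]setTI; apply: measurable_tuple_uncons => //.
    exact: measurableX.
  rewrite /mu' /= /pushforward -comp_preimage.
  rewrite (_ : _ @^-1` _ = F k `*` G k); last first.
    apply/seteqP; split => p.
      by rewrite -[X in _ -> (F k `*` G k) X](tuple_unconsK p).
    by rewrite -[X in (F k `*` G k) X -> _](tuple_unconsK p).
  by rewrite product_measure1E// lte_mul_pinfty// ge0_fin_numE.
pose sfm := Measure_isSigmaFinite.Build _ _ _ mu' sf.
pose mu'' : {sigma_finite_measure set (n.+1.-tuple R[i]) -> \bar R} :=
  HB.pack (mu' : set (n.+1.-tuple R[i]) -> \bar R) (Measure.on mu') sfm.
by exists mu''; rewrite /= muE.
Qed.

Section lebesgueCn_instance.
Variable n : nat.

Let lebesgueCn0 : @lebesgueCn R n set0 = 0.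
Proof. by have [mu ->] := lebesgueCn_sigma_finite_measure n;
  exact: measure0. Qed.

Let lebesgueCn_ge0 A : 0 <= @lebesgueCn R n A.
Proof. by have [mu ->] := lebesgueCn_sigma_finite_measure n;
  exact: measure_ge0. Qed.

Let lebesgueCn_sigma_additive : semi_sigma_additive (@lebesgueCn R n).
Proof.
have [mu ->] := lebesgueCn_sigma_finite_measure n.
exact: measure_semi_sigma_additive.
Qed.

HB.instance Definition _ := isMeasure.Build _ _ _ (@lebesgueCn R n)
  lebesgueCn0 lebesgueCn_ge0 lebesgueCn_sigma_additive.

Let lebesgueCn_sigma_finite : sigma_finite setT (@lebesgueCn R n).
Proof.
have [mu ->] := lebesgueCn_sigma_finite_measure n; exact: sigma_finiteT.
Qed.

HB.instance Definition _ := Measure_isSigmaFinite.Build _ _ _ (@lebesgueCn R n)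
  lebesgueCn_sigma_finite.

End lebesgueCn_instance.

Lemma ge0_integral_lebesgueCnS n (f : n.+1.-tuple R[i] -> \bar R) :
  measurable_fun setT f -> (forall z, 0 <= f z) ->
  \int[@lebesgueCn R n.+1]_z f z =
  \int[mC]_x \int[@lebesgueCn R n]_s f (tuple_cons (x, s)).
Proof.
move=> mf f0.
transitivity (\int[@lebesgueC R \x @lebesgueCn R n]_p f (tuple_cons p)).
  rewrite -[RHS](@ge0_integral_pushforward _ _ _ _ _ _
    (@measurable_tuple_cons n)
    (@lebesgueC R \x @lebesgueCn R n) setT f)//.
rewrite fubini_tonelli1//.
exact: measurableT_comp mf (@measurable_tuple_cons n).
Qed.

Definition box n (A : 'I_n -> set R[i]) : set (n.-tuple R[i]) :=
  [set z | forall i, A i (tnth z i)].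

Lemma measurable_box n (A : 'I_n -> set R[i]) :
  (forall i, measurable (A i)) -> measurable (box A).
Proof.
move=> mA; rewrite (_ : box A = \big[setI/setT]_(i <- enum 'I_n)
  ((@tnth n R[i])^~ i @^-1` A i)).
  apply: bigsetI_measurable => i _.
  by rewrite -[X in measurable X]setTI; exact: measurable_tnth.
rewrite -bigcap_seq; apply/seteqP; split => z zA i; first by move=> _;
  exact: zA.
by apply: zA; rewrite /= mem_enum.
Qed.

Lemma lebesgueCn_box n (A : 'I_n -> set R[i]) :
  (forall i, measurable (A i)) ->
  @lebesgueCn R n (box A) = \prod_(i < n) @lebesgueC R (A i).
Proof.
elim: n A => [|n IHn] A mA.
  rewrite big_ord0 /= diracE mem_set//.
  by case.
rewrite big_ord_recl -IHn//.
rewrite -product_measure1E//; last exact: measurable_box.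
rewrite /= /pushforward; congr (product_measure1 _ _ _).
apply/seteqP; split => -[x s]/=.
  move=> zA; have {}zA : forall i, A i (tnth (tuple_cons (x, s)) i) := zA.
  by split=> [|i]/=; [exact: (zA ord0)|have := zA (lift ord0 i); rewrite tnthS].
move=> [xA sA] i; case: (unliftP ord0 i) => [j ->|-> //].
by rewrite tnthS.
Qed.

Lemma bounded_tuple n (z : n.-tuple R[i]) :
  exists k, forall i, square k (tnth z i).
Proof.
have kP (w : R[i]) : exists k, square k w.
  have : [set: R[i]] w by [].
  by rewrite -bigcup_square => -[k _ wk]; exists k.
have [k zk] := choice (fun i => kP (tnth z i)).
exists (\max_(i < n) k i)%N => i.
have [] := zk i; rewrite /square /= !in_itv/= -!ler_norml => Re Im.
have ki : ((k i)%:R <= (\max_(i < n) k i)%:R :> R)%R by rewrite ler_nat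
  leq_bigmax.
by split; [exact: le_trans Re ki|exact: le_trans Im ki].
Qed.

(** Boxes with sides of finite measure are stable under intersection and generate the sigma-algebra
    of tuples, and the cubes [box (fun=> square k)] exhaust the space. *)
Lemma box_measure_unique n (m1 m2 : {measure set (n.-tuple R[i]) -> \bar R}) :
  (forall A : 'I_n -> set R[i], (forall i, measurable (A i)) ->
     (forall i, @lebesgueC R (A i) < +oo) -> m1 (box A) = m2 (box A)) ->
  (forall A : 'I_n -> set R[i], (forall i, measurable (A i)) ->
     (forall i, @lebesgueC R (A i) < +oo) -> m1 (box A) < +oo) ->
  forall B, measurable B -> m1 B = m2 B.
Proof.
move=> m12 m1oo.
pose G : set (set (n.-tuple R[i])) := [set B | exists A : 'I_n -> set R[i],
  [/\ forall i, measurable (A i), forall i,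
    @lebesgueC R (A i) < +oo & B = box A]].
have mG : G `<=` measurable.
  by move=> _ [A [mA _ ->]]; exact: measurable_box.
apply: (measure_unique G (fun k => box (fun=> square k))) => //.
- apply/seteqP; split; last first.
    apply: smallest_sub => //; exact: sigma_algebra_measurable.
  apply: smallest_sub; first exact: smallest_sigma_algebra.
  rewrite -bigcup_seq => B [i _ [Y mY <-]]; rewrite setTI.
  (* A cylinder need not have sides of finite measure, so it is written as a countable union of
     truncated boxes. *)
  have -> : (@tnth n R[i])^~ i @^-1` Y =
      \bigcup_k box (fun j => if j == i then square k `&` Y else square k).
    apply/seteqP; split => z /=.
      move=> zY; have [k zk] := bounded_tuple z; exists k => // j.
      by case: eqP => [->|_]; [split|]; do ?exact: zk.
    by move=> [k _ /(_ i)]; rewrite eqxx => -[].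
  apply: sigma_algebra_bigcup => k; apply: sub_sigma_algebra.
  exists (fun j => if j == i then square k `&` Y else square k); split => // j.
    by case: ifP => _; [apply: measurableI|]; do ?exact: measurable_square.
  case: ifP => _; last exact: lebesgueC_square.
  apply: le_lt_trans (lebesgueC_square k); apply: le_measure; rewrite ?inE//.
    by apply: measurableI => //; exact: measurable_square.
  exact: measurable_square.
- move=> _ _ [A [mA Aoo ->]] [B [mB Boo ->]]; exists (fun i => A i `&` B i);
    split.
  + by move=> i; exact: measurableI.
  + move=> i; apply: le_lt_trans (Aoo i); apply: le_measure; rewrite ?inE//.
    exact: measurableI.
  + apply/seteqP; split => z; first by move=> [zA zB] i; split;
      [exact: zA|exact: zB].
    by move=> zAB; split => i; have [] := zAB i.
- move=> k; exists (fun=> square k); split => // i.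
    exact: measurable_square.
  exact: lebesgueC_square.
- apply/seteqP; split => // z _.
  by have [k zk] := bounded_tuple z; exists k.
- by move=> B [A [mA Aoo ->]]; exact: m12.
- move=> k; apply: m1oo => i; [exact: measurable_square|exact:
    lebesgueC_square].
Qed.

End lebesgueCn_measure.

(** * Integration against a measure with a density *)

Section density_measure.
Context d (T : measurableType d) (R : realType).
Local Open Scope ereal_scope.
Variables (mu : {measure set T -> \bar R}) (w : T -> R).
Hypotheses (mw : measurable_fun setT w) (w0 : forall x, (0 <= w x)%R).

(* The arguments [mw] and [w0] only serve to infer the measure structure. *)
Definition density_measure (mw : measurable_fun setT w)
  (w0 : forall x, (0 <= w x)%R) (A : set T) : \bar R :=
  \int[mu]_(x in A) (w x)%:E.

Local Notation nu := (density_measure mw w0).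

Let mwE : measurable_fun setT (fun x => (w x)%:E).
Proof. exact/measurable_EFinP. Qed.

Let w0E x : 0 <= (w x)%:E. Proof. by rewrite lee_fin. Qed.

Let density0 : nu set0 = 0. Proof. exact: integral_set0. Qed.

Let density_ge0 A : 0 <= nu A. Proof. by apply: integral_ge0. Qed.

Let density_sigma_additive : semi_sigma_additive nu.
Proof.
move=> F mF tF mUF.
rewrite /density_measure ge0_integral_bigcup//; last exact: measurable_funTS.
by apply: is_cvg_nneseries => n _ _; exact: integral_ge0.
Qed.

HB.instance Definition _ := isMeasure.Build _ _ _ nu
  density0 density_ge0 density_sigma_additive.

Import HBNNSimple.

(** For indicators this is the definition of the measure; it extends to simple functions by
    linearity and to [f] by monotone convergence on both sides. *)
Lemma ge0_integral_density (f : T -> \bar R) :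
  measurable_fun setT f -> (forall x, 0 <= f x) ->
  \int[nu]_x f x = \int[mu]_x (f x * (w x)%:E).
Proof.
move=> mf f0; pose f_ := nnsfun_approx measurableT mf.
have f_0 n x : 0 <= (f_ n x)%:E by rewrite lee_fin.
have mf_ n : measurable_fun setT (fun x => (f_ n x)%:E) by
  exact/measurable_EFinP.
have ndf_ x : setT x -> {homo (fun n => (f_ n x)%:E) : n m / (n <= m)%N >->
  n <= m}.
  by move=> _ n m nm; rewrite lee_fin; exact/lefP/nd_nnsfun_approx.
have cvgf x : EFin \o f_^~ x @ \oo --> f x by apply: cvg_nnsfun_approx.
transitivity (limn (fun n => \int[nu]_x (f_ n x)%:E)).
  rewrite -monotone_convergence//.
  by apply: eq_integral => x _; apply/esym/cvg_lim => //; exact: cvgf.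
transitivity (limn (fun n => \int[mu]_x ((f_ n x)%:E * (w x)%:E))); last first.
  rewrite -monotone_convergence//.
  - apply: eq_integral => x _; apply/cvg_lim => //.
    by apply: cvgeZr => //; exact: cvgf.
  - by move=> n; exact: emeasurable_funM.
  - by move=> n x _; exact: mule_ge0.
  - by move=> x _ n m nm; rewrite lee_wpmul2r//; exact: ndf_.
congr (limn _); apply/funext => n.
transitivity (\int[nu]_x (\sum_(r \in range (f_ n))
  (r * \1_(f_ n @^-1` [set r]) x)%:E)).
  by apply: eq_integral => x _; rewrite fsumEFin// -fimfunE.
have mi (A : set T) : measurable A ->
  measurable_fun setT (fun x => (\1_A x : R)%:E).
  by move=> mA; exact/measurable_EFinP.
rewrite ge0_integral_fsum//; last 2 first.
- by move=> r; exact/measurable_EFinP/measurableT_comp.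
- by move=> r x _; rewrite EFinM nnfun_muleindic_ge0.
transitivity (\sum_(r \in range (f_ n))
    \int[mu]_x ((r * \1_(f_ n @^-1` [set r]) x)%:E * (w x)%:E)); last first.
  rewrite -ge0_integral_fsum//; last 2 first.
  - move=> r; apply: emeasurable_funM => //.
    exact/measurable_EFinP/measurableT_comp.
  - by move=> r x _; rewrite mule_ge0// EFinM nnfun_muleindic_ge0.
  apply: eq_integral => x _.
  rewrite -ge0_mule_fsuml; last by move=> r; rewrite EFinM nnfun_muleindic_ge0.
  by rewrite fsumEFin// -fimfunE.
apply: eq_fsbigr => r; rewrite inE => -[x _ <-].
have mA : measurable (f_ n @^-1` [set f_ n x]) by [].
rewrite integralZl_indic_nnsfun// integral_indic// setIT.
under [RHS]eq_integral do rewrite EFinM -muleA.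
rewrite [RHS]ge0_integralZl//; last 2 first.
- by apply: emeasurable_funM => //; exact: mi.
- by move=> y _; rewrite mule_ge0// lee_fin.
congr (_ * _); rewrite /density_measure [LHS]integral_mkcond.
apply: eq_integral => y _; rewrite patchE indicE.
by case: ifPn => _; rewrite ?mul1e ?mul0e.
Qed.

End density_measure.

(** * Integrals of products over a partition of the coordinates *)

Section partition_fubini.
Context {R : realType}.
Local Open Scope ereal_scope.
Local Notation mCn := (@lebesgueCn R _).

(** The construction of [residue_subfamily] for an arbitrary set of indices; on a residue class the
    two are convertible. *)
Definition subfamily N (S : {set 'I_N}) (z : N.-tuple R[i]) :
  #|S|.-tuple R[i] :=
  [tuple tnth z (enum_val j) | j < #|S|].

Lemma measurable_subfamily N (S : {set 'I_N}) :
  measurable_fun setT (subfamily S).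
Proof.
apply/measurable_fun_tnthP => j;
  rewrite (_ : _ \o _ = (@tnth N R[i])^~ (enum_val j)).
  exact: measurable_tnth.
by apply/funext => z /=; rewrite tnth_mktuple.
Qed.

Lemma integral_indic_weight d (T : measurableType d)
  (mu : {measure set T -> \bar R})
    (D : set T) (f : T -> R) :
  \int[mu]_(x in D) (f x)%:E = \int[mu]_x (\1_D x * f x)%:E.
Proof.
rewrite integral_mkcond; apply: eq_integral => x _.
by rewrite patchE indicE; case: ifP => _; rewrite ?mul1r ?mul0r.
Qed.

Variables (N : nat) (I : finType) (S : I -> {set 'I_N}) (c : 'I_N -> I).
Hypothesis hS : forall i k, (i \in S k) = (c i == k).

Definition weights := forall k, #|S k|.-tuple R[i] -> R.
Implicit Types g : weights.

Definition weight_ok g := forall k,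
  measurable_fun setT (g k) /\ forall s, (0 <= g k s)%R.

Definition factorizes g :=
  \int[mCn]_z (\prod_k g k (subfamily (S k) z))%:E =
  \prod_k \int[mCn]_s (g k s)%:E.

Definition restrict_sides (A : 'I_N -> set R[i]) (k : I) : 'I_#|S k| ->
  set R[i] :=
  fun j => A (enum_val j).

Lemma prod_indic_box (A : 'I_N -> set R[i]) z :
  (\prod_k \1_(box (restrict_sides A (k := k))) (subfamily (S k) z) =
   \1_(box A) z :> R)%R.
Proof.
have boxE n (B : 'I_n -> set R[i]) (s : n.-tuple R[i]) :
    \1_(box B) s = (\prod_(i < n) \1_(B i) (tnth s i))%R :> R.
  have [zB|zB] := pselect (box B s).
    by rewrite indicE mem_set// big1// => i _; rewrite indicE mem_set.
  have [i Bi] : exists i, ~ B i (tnth s i) by apply: contrapT => /forallNP H;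
    apply: zB => i; apply: contrapT.
  by rewrite indicE memNset// (bigD1 i)//= indicE memNset// mul0r.
rewrite boxE (partition_big c predT)//=; apply: eq_bigr => k _.
rewrite boxE (eq_bigl (mem (S k))); last by move=> i; rewrite /= hS.
rewrite [RHS]big_enum_val; apply: eq_bigr => j _.
by rewrite /restrict_sides tnth_mktuple.
Qed.

(** Both sides are the product of the measures of all the [A i], grouped by classes on the right. *)
Lemma factorizes_box (A : 'I_N -> set R[i]) : (forall i, measurable (A i)) ->
  factorizes (fun k => \1_(box (restrict_sides A (k := k)))).
Proof.
move=> mA; rewrite /factorizes.
under eq_integral do rewrite prod_indic_box.
rewrite integral_indic//; last exact: measurable_box.
rewrite setIT [LHS]lebesgueCn_box// (partition_big c predT)//=;
  apply: eq_bigr => k _.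
rewrite integral_indic//; last by apply: measurable_box => j; exact: mA.
rewrite setIT [RHS]lebesgueCn_box; last by move=> j; exact: mA.
rewrite (eq_bigl (mem (S k))); last by move=> i; rewrite /= hS.
by rewrite [LHS]big_enum_val.
Qed.

Lemma prod_dfwith g k (h : #|S k|.-tuple R[i] -> R) z :
  (\prod_l dfwith g k h l (subfamily (S l) z) =
  h (subfamily (S k) z) * \prod_(l | l != k) g l (subfamily (S l) z))%R.
Proof.
rewrite (bigD1 k)//= dfwithin; congr (_ * _)%R; apply: eq_bigr => l lk.
by rewrite dfwithout// eq_sym.
Qed.

Lemma eprod_dfwith g k (h : #|S k|.-tuple R[i] -> R) :
  \prod_l \int[mCn]_s (dfwith g k h l s)%:E =
  \int[mCn]_s (h s)%:E * \prod_(l | l != k) \int[mCn]_s (g l s)%:E.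
Proof.
rewrite (bigD1 k)//= dfwithin; congr (_ * _); apply: eq_bigr => l lk.
by rewrite dfwithout// eq_sym.
Qed.

Lemma measurable_prod_subfamily g (P : pred I) : weight_ok g ->
  measurable_fun setT (fun z => \prod_(l | P l) g l (subfamily (S l) z))%R.
Proof.
move=> gok; under eq_fun do rewrite big_mkcond/=.
apply: measurable_prod => l _; case: (P l) => /=; last exact: measurable_cst.
by apply: (measurableT_comp (gok l).1); exact: measurable_subfamily.
Qed.

Lemma weight_ok_dfwith g k (h : #|S k|.-tuple R[i] -> R) : weight_ok g ->
  measurable_fun setT h -> (forall s, 0 <= h s)%R -> weight_ok (dfwith g k h).
Proof.
move=> gok mh h0 l; case: (eqVneq k l) => [<-|kl];
  first by rewrite (@dfwithin _ _ g k h).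
by rewrite (@dfwithout _ _ g k h l)//; exact: gok.
Qed.

(* As functions of [g k], both sides are integrals against measures, which agree
   on boxes. *)
Lemma factorizes_box_ext g k : weight_ok g ->
  (forall l, l != k -> \int[mCn]_s (g l s)%:E < +oo) ->
  (forall A : 'I_#|S k| -> set R[i], (forall j, measurable (A j)) ->
     (forall j, @lebesgueC R (A j) < +oo) ->
     factorizes (dfwith g k (\1_(box A)))) ->
  factorizes g.
Proof.
move=> gok gfin boxok.
pose w z := (\prod_(l | l != k) g l (subfamily (S l) z))%R.
have mw : measurable_fun setT w by exact: measurable_prod_subfamily.
have w0 z : (0 <= w z)%R by apply: prodr_ge0 => l _; exact: (gok l).2.
pose c0 : \bar R := \prod_(l | l != k) \int[mCn]_s (g l s)%:E.
have c00 : 0 <= c0.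
  by apply: prode_ge0 => l _; apply: integral_ge0 => s _;
    rewrite lee_fin (gok l).2.
have c0fin : c0 \is a fin_num.
  rewrite /c0; elim/big_ind: _ => // [x y|l lk]; first exact: fin_numM.
  rewrite ge0_fin_numE ?gfin//; apply: integral_ge0 => s _.
  by rewrite lee_fin (gok l).2.
(* [mscale] takes a real factor: this is where the integrals of the other factors have to be
   finite. *)
pose r0 : {nonneg R} := NngNum (fine_ge0 c00).
have r0E : c0 = (r0%:num)%:E by rewrite /r0/= fineK.
pose nu : {measure set (N.-tuple R[i]) -> \bar R} :=
  density_measure (@lebesgueCn R N) mw w0.
pose m1 : {measure set (#|S k|.-tuple R[i]) -> \bar R} :=
  measure_function_pushforward__canonical__measure_function_Measure
    nu (@measurable_subfamily N (S k)).
pose m2 : {measure set (#|S k|.-tuple R[i]) -> \bar R} :=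
  mscale r0 (@lebesgueCn R #|S k|).
have m2E B : m2 B = c0 * @lebesgueCn R _ B by rewrite r0E.
have m1box (A : 'I_#|S k| -> set R[i]) : (forall j, measurable (A j)) ->
    (forall j, @lebesgueC R (A j) < +oo) -> m1 (box A) = m2 (box A).
  move=> mA Aoo.
  have := boxok A mA Aoo; rewrite /factorizes eprod_dfwith -/c0.
  rewrite integral_indic ?setIT//; last exact: measurable_box.
  rewrite muleC m2E => <-; rewrite /m1/= /pushforward /nu/=.
  rewrite /density_measure integral_indic_weight; apply: eq_integral => z _.
  by rewrite prod_dfwith.
have m12 B : measurable B -> m1 B = m2 B.
  apply: box_measure_unique => A mA Aoo; first exact: m1box.
  rewrite m1box//.
  rewrite m2E lebesgueCn_box//.
  rewrite ltey_eq fin_numM//; elim/big_ind: _ => // [x y|j _];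
    first exact: fin_numM.
  by rewrite ge0_fin_numE ?Aoo.
have mgk : measurable_fun setT (fun s => (g k s)%:E) by apply/measurable_EFinP;
  exact: (gok k).1.
have gk0 s : 0 <= (g k s)%:E by rewrite lee_fin (gok k).2.
transitivity (\int[m1]_s (g k s)%:E).
  rewrite ge0_integral_pushforward//=; last exact: measurable_subfamily.
  rewrite preimage_setT ge0_integral_density//; last first.
    by apply: (measurableT_comp mgk); exact: measurable_subfamily.
  by apply: eq_integral => z _; rewrite (bigD1 k)// EFinM.
transitivity (\int[m2]_s (g k s)%:E).
  by apply: eq_measure_integral => A mA _; exact: m12.
rewrite ge0_integral_mscale// -r0E muleC.
by rewrite (bigD1 k).
Qed.

Lemma integral_indic_box n (A : 'I_n -> set R[i]) :
  (forall j, measurable (A j)) -> (forall j, @lebesgueC R (A j) < +oo) ->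
  \int[@lebesgueCn R n]_s (\1_(box A) s)%:E < +oo.
Proof.
move=> mA Aoo; rewrite integral_indic ?setIT//; last exact: measurable_box.
rewrite [ltLHS]lebesgueCn_box// ltey_eq.
suff -> : \prod_(i < n) @lebesgueC R (A i) \is a fin_num by [].
elim/big_ind: _ => // [x y|j _]; first exact: fin_numM.
by rewrite ge0_fin_numE ?Aoo.
Qed.

Lemma factorizes_finite g : weight_ok g ->
  (forall k, \int[mCn]_s (g k s)%:E < +oo) -> factorizes g.
Proof.
(* [K] contains the indices whose factor may still differ from the indicator of a box; the induction
   on [K] replaces one such factor at a time. *)
suff H (K : seq I) : forall g, weight_ok g ->
    (forall k, \int[mCn]_s (g k s)%:E < +oo) ->
    (forall k, k \notin K -> exists A : 'I_#|S k| -> set R[i],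
      [/\ forall j, measurable (A j), forall j, @lebesgueC R (A j) < +oo &
          g k = \1_(box A)]) -> factorizes g.
  by move=> gok gfin; apply: (H (enum I)) => // k; rewrite mem_enum.
elim: K => [|k K IHK] {}g gok gfin gbox.
  pose A k := sval (cid (gbox k isT)).
  have AP k : [/\ forall j, measurable (A k j), forall j,
    @lebesgueC R (A k j) < +oo &
      g k = \1_(box (A k))] by exact: (svalP (cid (gbox k isT))).
  have Sc i : i \in S (c i) by rewrite hS.
  (* The boxes of the blocks are glued into one box: coordinate [i] takes the side found at its rank
     in its own class. *)
  pose B i := A (c i) (enum_rank_in (Sc i) i).
  have BA i k (Hi : i \in S (c i)) (j : 'I_#|S k|) : c i = k ->
    enum_val j = i ->
      A (c i) (enum_rank_in Hi i) = A k j.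
    by move=> ck; move: j; rewrite -ck => j ji; congr (A _ _);
      apply: enum_val_inj; rewrite enum_rankK_in.
  have gE : g = fun k => \1_(box (restrict_sides B (k := k))).
    apply: functional_extensionality_dep => k; have [_ _ ->] := AP k.
    congr (\1_(box _)); apply/funext => j; rewrite /restrict_sides /B.
    rewrite (BA (enum_val j) k _ j)//; apply/eqP; rewrite -hS.
    exact: enum_valP.
  rewrite gE; apply: factorizes_box => i.
  by have [+ _ _] := AP (c i); exact.
apply: (factorizes_box_ext (k := k)) => // A mA Aoo.
apply: IHK => [|l|l lK].
- by apply: weight_ok_dfwith => //; apply: measurable_indic;
    exact: measurable_box.
- have [<-|kl] := eqVneq k l; last by rewrite dfwithout.
  by rewrite dfwithin integral_indic_box.
- have [<-|kl] := eqVneq k l; first by rewrite dfwithin; exists A.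
  by rewrite dfwithout//; apply: gbox; rewrite inE negb_or eq_sym kl.
Qed.

Lemma integral_prod_partition g : weight_ok g ->
  \int[mCn]_z (\prod_k g k (subfamily (S k) z))%:E =
  \prod_k \int[mCn]_s (g k s)%:E.
Proof.
(* Here [K] contains the indices whose integral may be infinite. *)
suff H (K : seq I) : forall g, weight_ok g ->
    (forall k, k \notin K -> \int[mCn]_s (g k s)%:E < +oo) -> factorizes g.
  by move=> gok; apply: (H (enum I)) => // k; rewrite mem_enum.
elim: K => [|k K IHK] {}g gok gfin.
  by apply: factorizes_finite => // k; exact: gfin.
(* As the integral of [g k] may be infinite, the domain of [g k] is cut into
   countably many pieces [D n] on which it is finite. *)
pose E n := box (fun=> square n) `&` [set s | (g k s <= n%:R)%R].
have mE n : measurable (E n).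
  apply: measurableI; first by apply: measurable_box => _;
    exact: measurable_square.
  rewrite -[X in measurable X]setTI.
  exact: (measurable_fun_ler (gok k).1 (measurable_cst _)).
have UE : \bigcup_n E n = setT.
  apply/seteqP; split => // s _.
  have [p sp] := bounded_tuple s.
  pose q := (Num.truncn (g k s)).+1.
  exists (maxn p q) => //; split => /=.
    move=> i; have [] := sp i; rewrite /square/= !in_itv/= -!ler_norml => Re Im.
    have pq : (p%:R <= (maxn p q)%:R :> R)%R by rewrite ler_nat leq_maxl.
    by split; [exact: le_trans Re pq|exact: le_trans Im pq].
  by rewrite (@le_trans _ _ q%:R)%R// ?ler_nat ?leq_maxr// ltW// truncnS_gt.
pose D := seqDU E.
have mD n : measurable (D n) by exact: seqDU_measurable.
have UD : \bigcup_n D n = setT by rewrite -seqDU_bigcup_eq.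
have tD : trivIset setT D by exact: trivIset_seqDU.
have mgk : measurable_fun setT (fun s => (g k s)%:E) by apply/measurable_EFinP;
  exact: (gok k).1.
have gk0 s : 0 <= (g k s)%:E by rewrite lee_fin (gok k).2.
have Dfin n : \int[mCn]_(s in D n) (g k s)%:E < +oo.
  apply: (@le_lt_trans _ _ (\int[mCn]_(s in E n) (g k s)%:E)).
    by apply: ge0_subset_integral => //;
      [exact: measurable_funTS|exact: subset_seqDU].
  apply: (@le_lt_trans _ _ (\int[mCn]_(s in E n) (n%:R)%:E)).
    apply: ge0_le_integral => //; first exact: measurable_funTS.
    by move=> s [_ /=]; rewrite lee_fin.
  rewrite integral_cst// lte_mul_pinfty// ?lee_fin//.
  apply: (@le_lt_trans _ _ (@lebesgueCn R _ (box (fun=> square n)))).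
    apply: le_measure; rewrite ?inE//; last exact: subIsetl.
    by apply: measurable_box => _; exact: measurable_square.
  have := @integral_indic_box #|S k| (fun=> square n).
  rewrite integral_indic//; last by apply: measurable_box => _;
    exact: measurable_square.
  rewrite setIT => H; exact: (H (fun=> measurable_square n)
    (fun=> lebesgueC_square n)).
pose C : \bar R := \prod_(l | l != k) \int[mCn]_s (g l s)%:E.
have C0 : 0 <= C.
  by apply: prode_ge0 => l _; apply: integral_ge0 => s _;
    rewrite lee_fin (gok l).2.
have mG : measurable_fun setT (fun z => (\prod_l g l (subfamily (S l) z))%:E).
  by apply/measurable_EFinP; exact: measurable_prod_subfamily.
have mDS n : measurable (subfamily (S k) @^-1` D n).
  by rewrite -[X in measurable X]setTI;
    apply: (@measurable_subfamily N (S k)) => //; exact: mD.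
transitivity (\sum_(n <oo) \int[mCn]_(z in subfamily (S k) @^-1` D n)
    (\prod_l g l (subfamily (S l) z))%:E).
  rewrite -ge0_integral_bigcup//.
  - by rewrite -preimage_bigcup UD preimage_setT.
  - exact: measurable_funTS.
  - by move=> z _; rewrite lee_fin prodr_ge0// => l _; exact: (gok l).2.
  - apply/trivIsetP => i j _ _ ij; rewrite -preimage_setI.
    by move/trivIsetP : tD => ->//; rewrite preimage_set0.
transitivity (\sum_(n <oo) \int[mCn]_(s in D n) (C * (g k s)%:E)).
  apply: eq_eseriesr => n _.
  rewrite integral_indic_weight.
  pose h s := (\1_(D n) s * g k s)%R.
  have mh : measurable_fun setT h by apply: measurable_funM;
    [exact: measurable_indic|exact: (gok k).1].
  have h0 s : (0 <= h s)%R by rewrite mulr_ge0// (gok k).2.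
  transitivity (\int[mCn]_z (\prod_l dfwith g k h l (subfamily (S l) z))%:E).
    apply: eq_integral => z _; rewrite prod_dfwith (bigD1 k)//= mulrA;
      congr (_ * _)%:E.
  rewrite (IHK (dfwith g k h)); last 2 first.
  - exact: weight_ok_dfwith.
  - move=> l lK; have [<-|kl] := eqVneq k l.
      by rewrite dfwithin -integral_indic_weight.
    by rewrite dfwithout//; apply: gfin; rewrite inE negb_or eq_sym kl.
  rewrite eprod_dfwith -integral_indic_weight ge0_integralZl//;
    last exact: measurable_funTS.
  by rewrite muleC.
rewrite -ge0_integral_bigcup//; last 2 first.
- by apply: measurable_funTS; exact: emeasurable_funM.
- by move=> s _; exact: mule_ge0.
by rewrite UD ge0_integralZl// [RHS](bigD1 k)// muleC.
Qed.

End partition_fubini.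

(** * Averaging a Vandermonde determinant over roots of unity *)

Section block_determinant.
Variables (K : comNzRingType) (n : nat).
Implicit Types (S T : {set 'I_n}) (A : 'M[K]_n).
Local Open Scope ring_scope.

Definition submatrix S A : 'M[K]_#|S| :=
  \matrix_(i, j) A (enum_val i) (enum_val j).

(** Padding a block with the identity keeps the size [n], so that blocks can be combined by matrix
    multiplication. *)
Definition identity_off S A : 'M[K]_n :=
  \matrix_(i, j) (if (i \in S) && (j \in S) then A i j else (i == j)%:R).

(** The sign of the reindexing occurs once for the rows and once for the columns. *)
Lemma det_reindex m (f : 'I_m -> 'I_n) (A : 'M[K]_n) : bijective f ->
  \det (\matrix_(i, j) A (f i) (f j)) = \det A.
Proof.
move=> fbij; have mn : m = n.
  by have := bij_eq_card fbij; rewrite !card_ord.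
case: _ / mn A f fbij => A f fbij.
have finj := bij_inj fbij.
pose s := perm finj.
rewrite -[\matrix_(i, j) _](_ : row_perm s (col_perm s A) = _); last first.
  by apply/matrixP => i j; rewrite !mxE !permE.
rewrite row_permE col_permE !det_mulmx !det_perm odd_permV mulrCA.
by rewrite -signr_addb addbb mulr1.
Qed.

(** Listing [S] before its complement turns the padded matrix into a block matrix whose second
    diagonal block is the identity. *)
Lemma det_identity_off S A : \det (identity_off S A) = \det (submatrix S A).
Proof.
pose f (i : 'I_(#|S| + #|~: S|)) : 'I_n :=
  match fintype.split i with inl j => enum_val j | inr j => enum_val j end.
have finj : injective f.
  move=> i j; rewrite /f; case: (fintype.splitP i) => i' ii';
    case: (fintype.splitP j) => j' jj' e.
  - by apply: val_inj; rewrite /= ii' jj' (enum_val_inj e).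
  - by have := enum_valP i'; have := enum_valP j'; rewrite -e inE => /negbTE ->.
  - by have := enum_valP j'; have := enum_valP i'; rewrite e inE => /negbTE ->.
  - by apply: val_inj; rewrite /= ii' jj' (enum_val_inj e).
have fbij : bijective f.
  by apply: inj_card_bij => //; rewrite !card_ord -[n in (n <= _)%N]card_ord
    -(cardsC S).
rewrite -(det_reindex _ fbij).
have fl j : f (lshift _ j) = enum_val j by rewrite /f (unsplitK (inl j)).
have fr j : f (rshift _ j) = enum_val j by rewrite /f (unsplitK (inr j)).
have -> : \matrix_(i, j) identity_off S A (f i) (f j) =
    block_mx (submatrix S A) 0 0 1%:M.
  apply/matrixP => i j; rewrite -(splitK i) -(splitK j) mxE.
  case: (fintype.split i) => i'; case: (fintype.split j) => j' /=.
  - by rewrite block_mxEul !fl !mxE !enum_valP.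
  - rewrite block_mxEur fl fr !mxE enum_valP; have := enum_valP j'.
    rewrite inE => jS; rewrite (negbTE jS)/=; case: eqP => // e.
    by rewrite -e enum_valP in jS.
  - rewrite block_mxEdl fl fr !mxE enum_valP; have := enum_valP i'.
    rewrite inE => iS; rewrite (negbTE iS)/=; case: eqP => // e.
    by rewrite e enum_valP in iS.
  - rewrite block_mxEdr !fr !mxE; have := enum_valP i'.
    by rewrite inE => /negbTE -> /=; rewrite (inj_eq enum_val_inj).
by rewrite det_ublock det1 mulr1.
Qed.

(** As [A] vanishes between [S] and [T], each row is nontrivial in at most one of the two
    factors. *)
Lemma identity_offU S T A : {in S, forall x, x \notin T} ->
  (forall i j, i \in S -> j \in T -> A i j = 0) ->
  (forall i j, i \in T -> j \in S -> A i j = 0) ->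
  identity_off (S :|: T)%SET A = identity_off S A *m identity_off T A.
Proof.
move=> dST AST ATS; apply/matrixP => i j; rewrite !mxE !inE.
have TS x : x \in T -> (x \in S) = false by move=> xT; apply: contraTF xT;
  exact: dST.
have [iS|iS] := boolP (i \in S).
  rewrite (bigD1 j)//= big1 => [|l lj].
    rewrite addr0 !mxE iS /= eqxx andbb.
    have [jT|jT] := boolP (j \in T); first rewrite (TS j)//=.
      by rewrite AST//; case: eqP => [ij|];
        [rewrite ij TS// in iS|rewrite mul0r].
    by rewrite orbF mulr1.
  rewrite !mxE iS/=; have [lT|lT] := boolP (l \in T).
    rewrite TS//=; case: eqP => [il|]; last by rewrite mul0r.
    by rewrite il TS in iS.
  by rewrite /= (negbTE lj) mulr0.
rewrite (bigD1 i)//= big1 => [|l li]; last first.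
  by rewrite !mxE (negbTE iS) /= eq_sym (negbTE li) mul0r.
rewrite addr0 !mxE (negbTE iS) eqxx mul1r /=.
have [iT|iT] := boolP (i \in T) => //=.
have [jT|jT] := boolP (j \in T); rewrite ?orbT ?orbF//.
have [jS|jS] := boolP (j \in S) => //.
by rewrite ATS//; case: eqP => // ij; rewrite -ij (negbTE iS) in jS.
Qed.

(** Induction on a list of classes: adjoining a class multiplies the padded matrix by that of the
    new block. *)
Lemma det_block (I : finType) (S : I -> {set 'I_n}) (c : 'I_n -> I) A :
  (forall i k, (i \in S k) = (c i == k)) ->
  (forall i j, c i != c j -> A i j = 0) ->
  \det A = \prod_k \det (submatrix (S k) A).
Proof.
move=> hS A0.
have H (r : seq I) : uniq r -> \det (identity_off [set i | c i \in r]%SET A) =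
    \prod_(k <- r) \det (submatrix (S k) A).
  elim: r => [_|k r IHr /= /andP[kr ur]].
    rewrite big_nil -[RHS](det1 K n); congr (\det _); apply/matrixP => i j.
    by rewrite !mxE !inE.
  rewrite big_cons -IHr// -det_identity_off -det_mulmx -identity_offU.
  - by congr (\det (identity_off _ _)); apply/setP => i; rewrite !inE hS.
  - by move=> i; rewrite hS inE => /eqP ->.
  - move=> i j; rewrite hS inE => /eqP ik jr; apply: A0.
    by rewrite ik; apply: contraNneq kr => ->.
  - move=> i j; rewrite hS inE => ir /eqP jk; apply: A0.
    by rewrite jk; apply: contraNneq kr => <-.
rewrite -[RHS]H ?index_enum_uniq//; congr (\det _); apply/matrixP => i j.
by rewrite !mxE !inE !mem_index_enum.
Qed.

End block_determinant.

(** * Orthogonality of roots of unity and the residue groups of the Leibniz expansion *)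

Section root_of_unity_average.
Variables (K : numClosedFieldType) (N M : nat).
Hypothesis M0 : (0 < M)%N.
Local Open Scope ring_scope.

(** ['X^M - 1] splits and is separable in characteristic 0, so it has [M] distinct roots; a set of
    that many roots of unity contains a primitive one. *)
Lemma prim_root_exists : {w : K | M.-primitive_root w}.
Proof.
pose p : {poly K} := 'X^M - 1; have [r Dp] := closed_field_poly_normal p.
apply/sigW; rewrite (monicP _) ?monicXnsubC// scale1r in Dp.
have rn1 : all M.-unity_root r by apply/allP => z; rewrite -root_prod_XsubC -Dp.
have sz_r : (M < (size r).+1)%N.
  by rewrite -(size_prod_XsubC r id) -Dp size_XnsubC.
have [|z] := hasP (has_prim_root M0 rn1 _ sz_r); last by exists z.
by rewrite -separable_prod_XsubC -Dp separable_Xn_sub_1// pnatr_eq0 -lt0n.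
Qed.

Variable w : K.
Hypothesis w_prim : M.-primitive_root w.

Lemma norm_prim_root : `|w| = 1.
Proof.
apply/eqP; rewrite -(@pexpr_eq1 _ _ M)// -normrX (prim_expr_order w_prim).
by rewrite normr1.
Qed.

(** For [a != b] the sum is geometric, and its ratio is an [M]-th root of unity other than 1. *)
Lemma root_orthogonality (a b : 'I_M) :
  \sum_(e < M) w ^+ (e * a) * (w ^+ (e * b))^* = M%:R *+ (a == b).
Proof.
have wa n : w ^+ n * (w ^+ n)^* = 1 by rewrite -normCK normrX norm_prim_root
  !expr1n.
have [->|ab] := eqVneq a b.
  under eq_bigr do rewrite wa.
  by rewrite sumr_const card_ord.
pose x := w ^+ a * (w ^+ b)^*.
have -> : \sum_(e < M) w ^+ (e * a) * (w ^+ (e * b))^* = \sum_(e < M) x ^+ e.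
  by apply: eq_bigr => e _; rewrite /x exprMn -rmorphXn -!exprM mulnC
    [(b * e)%N]mulnC.
have x1 : x != 1.
  apply: contra_neq ab => x1; apply: val_inj; apply/eqP => /=.
  rewrite -(modn_small (ltn_ord a)) -(modn_small (ltn_ord b)).
  rewrite -(eq_prim_root_expr w_prim) -[eqbLHS]mulr1 -(wa b).
  by rewrite mulrA mulrAC -/x x1 mul1r.
have xM : x ^+ M = 1.
  rewrite /x exprMn -rmorphXn -!exprM ![(_ * M)%N]mulnC !exprM.
  by rewrite (prim_expr_order w_prim) !expr1n rmorph1 mulr1.
have /eqP := subrX1 x M; rewrite xM subrr eq_sym mulf_eq0 subr_eq0
  (negbTE x1)/=.
by move=> /eqP.
Qed.

Lemma root_parseval (D : {ffun 'I_N -> 'I_M} -> K) :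
  \sum_(e : {ffun 'I_N -> 'I_M})
     `|\sum_(c : {ffun 'I_N -> 'I_M}) (\prod_i w ^+ (e i * c i)) * D c| ^+ 2 =
  M%:R ^+ N * \sum_(c : {ffun 'I_N -> 'I_M}) `|D c| ^+ 2.
Proof.
pose chi (e c : {ffun 'I_N -> 'I_M}) := \prod_i w ^+ (e i * c i).
have orth c c' : \sum_(e : {ffun 'I_N -> 'I_M}) chi e c * (chi e c')^* =
    M%:R ^+ N *+ (c == c').
  transitivity (\prod_(i < N) \sum_(e < M) w ^+ (e * c i) *
    (w ^+ (e * c' i))^*).
    rewrite bigA_distr_bigA; apply: eq_bigr => e _.
    by rewrite /chi rmorph_prod -big_split.
  under eq_bigr do rewrite root_orthogonality.
  have [->|cc'] := eqVneq c c'.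
    by under eq_bigr do rewrite eqxx mulr1n; rewrite prodr_const card_ord.
  have [i ci] : exists i, c i != c' i.
    apply/existsP; rewrite -negb_forall; apply: contra cc' => /forallP H.
    by apply/eqP/ffunP => i; exact/eqP.
  by rewrite (bigD1 i)//= (negbTE ci) mulr0n mul0r.
transitivity (\sum_(e : {ffun 'I_N -> 'I_M}) \sum_(c : {ffun 'I_N -> 'I_M})
    \sum_(c' : {ffun 'I_N -> 'I_M}) (chi e c * (chi e c')^*) *
      (D c * (D c')^*)).
  apply: eq_bigr => e _; rewrite normCK rmorph_sum big_distrlr/=.
  apply: eq_bigr => c _; apply: eq_bigr => c' _.
  by rewrite rmorphM mulrACA.
rewrite exchange_big mulr_sumr; apply: eq_bigr => c _; rewrite exchange_big/=.
rewrite (bigD1 c)//= -mulr_suml orth eqxx mulr1n normCK big1 ?addr0// => c' c'c.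
by rewrite -mulr_suml orth eq_sym (negbTE c'c) mul0r.
Qed.

Definition class_of_exponent (j : 'I_N) : 'I_M := Ordinal (ltn_pmod j M0).
Local Notation cl := class_of_exponent.

(* The part of the Leibniz expansion of the Vandermonde determinant of [z] in
   which the exponent of [z i] has residue [c i]. *)
Definition vandermonde_part (z : 'I_N -> K) (c : {ffun 'I_N -> 'I_M}) : K :=
  \sum_(s : 'S_N | [forall i, cl (s i) == c i]) (-1) ^+ s * \prod_i z i ^+ s i.

(** Since [w ^+ M = 1], a rotation multiplies a Leibniz term by a factor that depends only on the
    residues of its exponents, hence only on its group. *)
Lemma det_rotation_expansion (z : 'I_N -> K) (e : {ffun 'I_N -> 'I_M}) :
  \det (\matrix_(i, j < N) (w ^+ e i * z i) ^+ j) =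
  \sum_(c : {ffun 'I_N -> 'I_M}) (\prod_i w ^+ (e i * c i)) * vandermonde_part z
    c.
Proof.
rewrite /determinant (partition_big (fun s : 'S_N => [ffun i => cl (s i)])
  predT)//=.
apply: eq_bigr => c _; rewrite /vandermonde_part mulr_sumr; apply: eq_big =>
  [s|s /eqP cs].
  apply/eqP/forallP => [<- i|H]; first by rewrite ffunE.
  by apply/ffunP => i; rewrite ffunE; exact/eqP.
rewrite mulrCA -big_split/=; congr (_ * _); apply: eq_bigr => i _.
rewrite mxE exprMn -exprM -cs ffunE/=; congr (_ * _).
by rewrite exprM [RHS]exprM -[LHS]exprM mulnC exprM
  -[in LHS](prim_expr_mod w_prim) -!exprM mulnC.
Qed.

(** The Leibniz sum is reindexed by left multiplication by [p]. Every nonzero group is thus, up to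
    sign, the group of the identity assignment at permuted points. *)
Lemma vandermonde_part_perm (z : 'I_N -> K) (p : 'S_N) :
  vandermonde_part z [ffun i => cl (p i)] =
  (-1) ^+ p * vandermonde_part (z \o (p^-1)%g) [ffun i => cl i].
Proof.
rewrite /vandermonde_part mulr_sumr (reindex_inj (mulgI p)); apply: eq_big =>
  [t|t _].
  apply/forallP/forallP => H i.
    by have := H ((p^-1)%g i); rewrite !ffunE permM permKV.
  by have := H (p i); rewrite !ffunE permM.
rewrite odd_permM signr_addb -mulrA; congr (_ * (_ * _)).
rewrite (reindex_inj (@perm_inj _ (p^-1)%g)); apply: eq_bigr => i _.
by rewrite permM permKV.
Qed.

Lemma vandermonde_part_neq0 (z : 'I_N -> K) c : vandermonde_part z c != 0 ->
  exists s : 'S_N, c = [ffun i => cl (s i)].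
Proof.
move=> zc; have [s sc] : exists s : 'S_N, [forall i, cl (s i) == c i].
  apply/existsP; apply: contraNT zc => /existsPn H.
  by rewrite /vandermonde_part big1// => s sc; have := H s; rewrite sc.
by exists s; apply/ffunP => i; rewrite ffunE; apply/esym/eqP;
  exact: (forallP sc).
Qed.

(** The size of every nonempty fibre of [p |-> [ffun i => cl (p i)]], since these fibres are the
    left translates of this set. It is the overcount when a sum over assignments is replaced by a
    sum over permutations. *)
Definition class_stabilizer := #|[set p :
  'S_N | [forall i, cl (p i) == cl i]]|%SET.

Lemma class_stabilizer_gt0 : (0 < class_stabilizer)%N.
Proof.
by apply/card_gt0P; exists 1%g; rewrite inE; apply/forallP => i; rewrite perm1.
Qed.

Lemma sum_perm_vandermonde_part (z : 'I_N -> K) :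
  \sum_(p : 'S_N) `|vandermonde_part (z \o p) [ffun i => cl i]| ^+ 2 =
  class_stabilizer%:R * \sum_(c : {ffun 'I_N -> 'I_M}) `|vandermonde_part z c|
    ^+ 2.
Proof.
transitivity (\sum_(p : 'S_N) `|vandermonde_part z [ffun i => cl (p i)]| ^+ 2).
  rewrite (reindex_inj invg_inj)/=; apply: eq_bigr => p _.
  by rewrite [in RHS]vandermonde_part_perm normrM normrX normrN1 expr1n mul1r.
rewrite (partition_big (fun p : 'S_N => [ffun i => cl (p i)]) predT)//.
rewrite mulr_sumr; apply: eq_bigr => c _.
rewrite (eq_bigr (fun=> `|vandermonde_part z c| ^+ 2)) => [|p /eqP <- //].
rewrite sumr_const -[LHS]mulr_natl.
have [->|/vandermonde_part_neq0[s cs]] := eqVneq (vandermonde_part z c) 0.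
  by rewrite normr0 expr0n !mulr0.
congr (_%:R * _); rewrite /class_stabilizer -[RHS](card_imset _ (mulgI s)).
apply: eq_card => p.
rewrite -[LHS]/([ffun i => cl (p i)] == c); apply/eqP/imsetP => [pc|[t]].
  exists (s^-1 * p)%g; last by rewrite mulKVg.
  rewrite inE; apply/forallP => i; rewrite permM.
  have := congr1 (fun f : {ffun 'I_N -> 'I_M} => f ((s^-1)%g i)) pc.
  by rewrite /= cs !ffunE permKV => ->.
rewrite inE => /forallP H ->; rewrite cs; apply/ffunP => i.
by rewrite !ffunE permM; exact/eqP.
Qed.

Lemma sum_rotations_perms (z : 'I_N -> K) :
  class_stabilizer%:R * (\sum_(e : {ffun 'I_N -> 'I_M})
     `|\det (\matrix_(i, j < N) (w ^+ e i * z i) ^+ j)| ^+ 2) =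
  M%:R ^+ N * \sum_(p : 'S_N) `|vandermonde_part (z \o p) [ffun i => cl i]| ^+
    2.
Proof.
under eq_bigr do rewrite det_rotation_expansion.
by rewrite root_parseval sum_perm_vandermonde_part mulrCA.
Qed.

(** Setting the entries between different classes to 0 removes from the determinant exactly the
    permutations that move some index to another class. *)
Lemma vandermonde_part_block (z : 'I_N -> K) (S : 'I_M -> {set 'I_N}) :
  (forall i k, (i \in S k) = (cl i == k)) ->
  vandermonde_part z [ffun i => cl i] =
  \prod_k \det (\matrix_(i, j < #|S k|) z (enum_val i) ^+ enum_val j).
Proof.
move=> hS.
pose A : 'M[K]_N := \matrix_(i, j) (z i ^+ j *+ (cl i == cl j)).
transitivity (\det A).
  rewrite /determinant (bigID (fun s : 'S_N => [forall i, cl (s i) == cl i]))/=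
    addrC big1 ?add0r.
    rewrite /vandermonde_part; apply: eq_big => [s|s H].
      by apply: eq_forallb => i; rewrite ffunE.
    congr (_ * _); apply: eq_bigr => i _; rewrite mxE.
    by have := forallP H i; rewrite ffunE eq_sym => /eqP ->; rewrite eqxx.
  move=> s /forallPn[i si]; rewrite (bigD1 i)//= mxE eq_sym (negbTE si).
  by rewrite mulr0n mul0r mulr0.
rewrite (det_block hS); last by move=> i j ij; rewrite mxE (negbTE ij).
apply: eq_bigr => k _; congr (\det _); apply/matrixP => i j; rewrite !mxE.
by have := enum_valP i; have := enum_valP j; rewrite !hS => /eqP -> /eqP ->;
  rewrite eqxx.
Qed.

(** The class consists of the numbers [k + M * a] with [a < #|S|]. The permutation [q] makes the
    order in which [enum_val] lists them irrelevant. *)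
Lemma residue_block_exponents (k : 'I_M) (S : {set 'I_N}) :
  (forall i, (i \in S) = (cl i == k)) ->
  exists q : 'S_#|S|, forall j : 'I_#|S|, enum_val j = (k + M * q j)%N :> nat.
Proof.
move=> hS.
have eS (i : 'I_N) : i \in S -> (i = k + M * (i %/ M) :> nat)%N.
  by rewrite hS => /eqP/(congr1 val)/= <-; rewrite {1}(divn_eq i M) addnC mulnC.
have qlt (j : 'I_#|S|) : (enum_val j %/ M < #|S|)%N.
  set q := (_ %/ M)%N; have jq := eS _ (enum_valP j); rewrite -/q in jq.
  (* The numbers [k + M * a] with [a <= q] are [q + 1] distinct elements of [S], which bounds the
     quotient [q]. *)
  have hlt (a : 'I_q.+1) : (k + M * a < N)%N.
    apply: leq_ltn_trans (ltn_ord (enum_val j)); rewrite jq leq_add2l leq_mul2l.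
    by rewrite -ltnS ltn_ord orbT.
  pose h a : 'I_N := Ordinal (hlt a).
  have hinj : injective h.
    move=> a b /(congr1 val)/= /addnI /eqP; rewrite eqn_mul2l (gtn_eqF M0)/=.
    by move=> /eqP/val_inj.
  rewrite -[q.+1]card_ord -(card_imset predT hinj).
  apply/subset_leq_card/fintype.subsetP => _ /imsetP[a _ ->]; rewrite hS.
  apply/eqP/val_inj => /=.
  by rewrite mulnC addnC modnMDl modn_small.
pose q j : 'I_#|S| := Ordinal (qlt j).
have qinj : injective q.
  move=> a b /(congr1 val)/= ab; apply/enum_val_inj/val_inj => /=.
  by rewrite (eS _ (enum_valP a)) (eS _ (enum_valP b)) ab.
exists (perm qinj) => j; rewrite permE; exact: eS (enum_valP j).
Qed.

(** Each row has the common factor [x i ^+ k]; what remains is a Vandermonde matrix in the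
    [x i ^+ M] with permuted columns. *)
Lemma norm_det_residue_block (k : 'I_M) (S : {set 'I_N}) (x : 'I_#|S| -> K) :
  (forall i, (i \in S) = (cl i == k)) ->
  `|\det (\matrix_(i, j < #|S|) x i ^+ enum_val j)| =
  (\prod_i `|x i| ^+ k) * `|\det (\matrix_(i, j < #|S|) (x i ^+ M) ^+ j)|.
Proof.
move=> hS; have [q qE] := residue_block_exponents hS.
have -> : \matrix_(i, j < #|S|) x i ^+ enum_val j =
    diag_mx (\row_i x i ^+ k) *m col_perm q
      (\matrix_(i, j < #|S|) (x i ^+ M) ^+ j).
  apply/matrixP => i j; rewrite mul_diag_mx !mxE qE exprD -exprM.
  by [].
rewrite det_mulmx det_diag col_permE det_mulmx det_perm !normrM normrX normrN1
  expr1n mulr1.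
congr (_ * _); rewrite normr_prod; apply: eq_bigr => i _.
by rewrite mxE normrX.
Qed.

End root_of_unity_average.

(** * Transformations of tuples and densities *)

Section lebesgueCn_transformations.
Context {R : realType}.
Local Open Scope ereal_scope.
Local Notation mCn := (@lebesgueCn R _).

Lemma ge0_integral_box_preserving n (phi : n.-tuple R[i] -> n.-tuple R[i])
    (f : n.-tuple R[i] -> \bar R) :
  measurable_fun setT phi ->
  (forall A : 'I_n -> set R[i], (forall i, measurable (A i)) ->
     @lebesgueCn R n (phi @^-1` box A) = \prod_(i < n) @lebesgueC R (A i)) ->
  measurable_fun setT f -> (forall z, 0 <= f z) ->
  \int[mCn]_z f (phi z) = \int[mCn]_z f z.
Proof.
move=> mphi phibox mf f0.
pose nu : {measure set (n.-tuple R[i]) -> \bar R} :=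
  measure_function_pushforward__canonical__measure_function_Measure
    (@lebesgueCn R n) mphi.
have boxoo (A : 'I_n -> set R[i]) : (forall i, @lebesgueC R (A i) < +oo) ->
    \prod_(i < n) @lebesgueC R (A i) < +oo.
  move=> Aoo; rewrite ltey_eq.
  suff -> : \prod_(i < n) @lebesgueC R (A i) \is a fin_num by [].
  elim/big_ind: _ => // [x y|j _]; first exact: fin_numM.
  by rewrite ge0_fin_numE ?Aoo.
have nuE B : measurable B -> nu B = @lebesgueCn R n B.
  apply: box_measure_unique => A mA Aoo.
    by rewrite [LHS]phibox// [RHS]lebesgueCn_box.
  by rewrite [ltLHS]phibox// boxoo.
transitivity (\int[nu]_z f z); first by rewrite ge0_integral_pushforward//
  preimage_setT.
by apply: eq_measure_integral => A mA _; exact: nuE.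
Qed.

Definition permute_tuple n (p : 'S_n) (z : n.-tuple R[i]) : n.-tuple R[i] :=
  [tuple tnth z (p i) | i < n].

Lemma measurable_permute_tuple n (p : 'S_n) :
  measurable_fun setT (permute_tuple p).
Proof.
apply/measurable_fun_tnthP => i; rewrite (_ : _ \o _ = (@tnth n R[i])^~ (p i)).
  exact: measurable_tnth.
by apply/funext => z /=; rewrite tnth_mktuple.
Qed.

Lemma ge0_integral_permute_tuple n (p : 'S_n) (f : n.-tuple R[i] -> \bar R) :
  measurable_fun setT f -> (forall z, 0 <= f z) ->
  \int[mCn]_z f (permute_tuple p z) = \int[mCn]_z f z.
Proof.
apply: ge0_integral_box_preserving; first exact: measurable_permute_tuple.
move=> A mA; rewrite (_ : _ @^-1` _ = box (fun i => A ((p^-1)%g i))).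
  by rewrite lebesgueCn_box// [RHS](reindex_inj (@perm_inj _ (p^-1)%g)).
apply/seteqP; split => z zA i.
  by have := zA ((p^-1)%g i); rewrite tnth_mktuple permKV.
by have := zA (p i); rewrite tnth_mktuple permK.
Qed.

Definition rotate_tuple n (u : 'I_n -> R[i]) (z : n.-tuple R[i]) :
  n.-tuple R[i] :=
  [tuple (u i * tnth z i)%R | i < n].

Lemma measurable_rotate_tuple n (u : 'I_n -> R[i]) :
  measurable_fun setT (rotate_tuple u).
Proof.
apply/measurable_fun_tnthP => i;
  rewrite (_ : _ \o _ = (fun z => u i * z)%R \o (@tnth n R[i])^~ i).
  by apply: measurableT_comp; [exact: measurable_fun_mulC|exact:
    measurable_tnth].
by apply/funext => z /=; rewrite tnth_mktuple.
Qed.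

Lemma lebesgueC_rotation (u : R[i]) (A : set R[i]) : normc u = 1%R ->
  measurable A -> lebesgueC ((fun z => u * z)%R @^-1` A) = lebesgueC A.
Proof.
move=> u1 mA.
have u0 : u != 0%R by rewrite -normc_eq0 u1 oner_eq0.
have mu : measurable ((fun z => u * z)%R @^-1` A).
  by rewrite -[X in measurable X]setTI; exact: measurable_fun_mulC.
have := @ge0_integral_mulC R u (fun z => (\1_A z)%:E) u0.
rewrite u1 expr1n mul1e integral_indic// setIT => ->; last 2 first.
- by apply/measurable_EFinP; exact: measurable_indic.
- by move=> z; rewrite lee_fin.
rewrite -[lebesgueC (_ @^-1` _)]/(mC (_ @^-1` _)).
by rewrite -[in LHS](setIT (_ @^-1` _)) -integral_indic.
Qed.

Lemma ge0_integral_rotate_tuple n (u : 'I_n -> R[i])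
  (f : n.-tuple R[i] -> \bar R) :
  (forall i, normc (u i) = 1%R) ->
  measurable_fun setT f -> (forall z, 0 <= f z) ->
  \int[mCn]_z f (rotate_tuple u z) = \int[mCn]_z f z.
Proof.
move=> u1; apply: ge0_integral_box_preserving;
  first exact: measurable_rotate_tuple.
move=> A mA; rewrite (_ : _ @^-1` _ = box
  (fun i => (fun z => u i * z)%R @^-1` A i)).
  rewrite lebesgueCn_box => [|i]; first by apply: eq_bigr => i _;
    exact: lebesgueC_rotation.
  by rewrite -[X in measurable X]setTI; exact: measurable_fun_mulC.
by apply/seteqP; split => z zA i; have := zA i; rewrite /= tnth_mktuple.
Qed.

Lemma measurable_powers M n : measurable_fun setT (@powers R M n).
Proof.
apply/measurable_fun_tnthP => i;
  rewrite (_ : _ \o _ = (fun z => z ^+ M)%R \o (@tnth n R[i])^~ i).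
  by apply: measurableT_comp; [exact: measurable_funXM|exact: measurable_tnth].
by apply/funext => z /=; rewrite /powers tnth_map.
Qed.

(** The substitution in one variable is applied to one coordinate at a time, by Tonelli's
    theorem. *)
Lemma ge0_integral_powers M n (f : n.-tuple R[i] -> \bar R) : (0 < M)%N ->
  measurable_fun setT f -> (forall z, 0 <= f z) ->
  \int[mCn]_z (f (powers M z) *
    (\prod_(i < n) (M%:R * normc (tnth z i) ^+ (2 * (M - 1))%N))%:E) =
  \int[mCn]_z f z.
Proof.
move=> M0; pose J (x : R[i]) : R := (M%:R * normc x ^+ (2 * (M - 1))%N)%R.
have J0 x : (0 <= J x)%R by rewrite mulr_ge0// exprn_ge0// normc_ge0.
have mJ : measurable_fun setT J.
  by apply: measurable_funM => //; apply: measurable_funX;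
    exact: measurable_normc.
elim: n f => [|n IHn] f mf f0.
  by apply: eq_integral => z _; rewrite big_ord0 mule1 [powers _ _]tuple0
    [z]tuple0.
have mJn m : measurable_fun setT
  (fun z : m.-tuple R[i] => \prod_(i < m) J (tnth z i))%R.
  apply: measurable_prod => i _; apply: (measurableT_comp mJ);
    exact: measurable_tnth.
have Jn0 m (z : m.-tuple R[i]) :
  (0 <= \prod_(i < m) J (tnth z i))%R by apply: prodr_ge0 => i _; exact: J0.
rewrite ge0_integral_lebesgueCnS; last 2 first.
- apply: emeasurable_funM; last by apply/measurable_EFinP; exact: mJn.
  by apply: (measurableT_comp mf); exact: measurable_powers.
- by move=> z; rewrite mule_ge0// lee_fin; exact: Jn0.
rewrite [RHS]ge0_integral_lebesgueCnS//.
have mfc : measurable_fun setT (f \o @tuple_cons R n).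
  exact: measurableT_comp mf (@measurable_tuple_cons R n).
pose H x := \int[mCn]_s f (tuple_cons (x, s)).
have mH : measurable_fun setT H.
  by apply: (@measurable_fun_fubini_tonelli_F _ _ _ _ _ (@lebesgueCn R n)
    (f \o @tuple_cons R n)) => // p; exact: f0.
have H0 x : 0 <= H x by apply: integral_ge0.
rewrite -(@ge0_integral_powC R M M0 H)//.
apply: eq_integral => x _; rewrite muleC.
have mfx (y : R[i]) : measurable_fun setT (fun s => f (tuple_cons (y, s))).
  exact: measurableT_comp mfc (measurable_pair1 y).
rewrite /H -(IHn (fun s => f (tuple_cons ((x ^+ M)%R, s))))//.
rewrite -ge0_integralZl//; last 3 first.
- apply: emeasurable_funM; last by apply/measurable_EFinP; exact: mJn.
  by apply: (measurableT_comp (mfx _)); exact: measurable_powers.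
- by move=> s _; rewrite mule_ge0// lee_fin; exact: Jn0.
- by rewrite lee_fin; exact: J0.
apply: eq_integral => s _.
rewrite big_ord_recl EFinM muleCA; congr (_ * (_ * _)).
- by congr f; apply/val_inj.
- by congr (_%:E); apply: eq_bigr => i _; rewrite tnthS.
Qed.

End lebesgueCn_transformations.

(** * The averaged Vandermonde factor as a sum of products of root weights *)

Section root_weight.
Context {R : realType}.
Local Open Scope ring_scope.

(** The root density without its potential, which is constant along the rotations and can be
    restored afterwards. *)
Definition root_weight M k n (s : n.-tuple R[i]) : R :=
  vandermonde_sqr (powers M s) * \prod_(i < n) normc (tnth s i) ^+
    (2 * (k - 1)).

Lemma norm_normc (x : R[i]) : `|x| = real_complex R (normc x).
Proof. by []. Qed.

Lemma vandermonde_sqrE n (z : n.-tuple R[i]) :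
  real_complex R (vandermonde_sqr z) =
  `|\det (\matrix_(i, j < n) tnth z i ^+ j)| ^+ 2.
Proof.
rewrite -det_tr.
have -> : (\matrix_(i, j < n) tnth z i ^+ j)^T = Vandermonde n
  (\row_i tnth z i).
  by apply/matrixP => i j; rewrite !mxE.
rewrite det_Vandermonde normr_prod -prodrXl /vandermonde_sqr rmorph_prod.
apply: eq_bigr => i _; rewrite normr_prod -prodrXl rmorph_prod;
  apply: eq_bigr => j _.
by rewrite !mxE distrC rmorphXn norm_normc.
Qed.

Lemma root_weight_ge0 M k n (s : n.-tuple R[i]) : 0 <= root_weight M k s.
Proof.
rewrite mulr_ge0 ?prodr_ge0// => i _; last by rewrite exprn_ge0// normc_ge0.
by apply: prodr_ge0 => j _; rewrite exprn_ge0// normc_ge0.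
Qed.

(** Points are numbered from 1 and exponents from 0; the two shifts by one cancel, so label [k.+1]
    corresponds to exponents of residue [k]. *)
Lemma residue_classE N M (M0 : (0 < M)%N) (i : 'I_N) (k : 'I_M) :
  (i \in residue_class N M k.+1) = (class_of_exponent M0 i == k).
Proof.
rewrite inE -addn1 -(addn1 k) eqn_modDr -val_eqE /=.
by rewrite (modn_small (ltn_ord k)).
Qed.

Lemma sum_rotations_root_weight N M : (0 < M)%N ->
  exists (K : nat) (u : 'I_M -> R[i]),
  [/\ (0 < K)%N, forall a, u a ^+ M = 1, forall a, normc (u a) = 1 &
    forall z : N.-tuple R[i],
    K%:R * \sum_(e : {ffun 'I_N -> 'I_M}) vandermonde_sqr
      (rotate_tuple (u \o e) z) =
    M%:R ^+ N * \sum_(p : 'S_N) \prod_(k < M)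
      root_weight M k.+1 (subfamily (residue_class N M k.+1)
        (permute_tuple p z))].
Proof.
move=> M0; have [w w_prim] := @prim_root_exists R[i] M M0.
exists (class_stabilizer N M0), (fun a => w ^+ a); split.
- exact: class_stabilizer_gt0.
- by move=> a; rewrite exprAC (prim_expr_order w_prim) expr1n.
- move=> a; apply: (@complexI R); rewrite -norm_normc normrX.
  by rewrite (norm_prim_root M0 w_prim) expr1n.
(* The determinant identity holds in [R[i]]; it descends to [R] by injectivity of the embedding. *)
move=> z; apply: (@complexI R).
rewrite !rmorphM !rmorph_sum !rmorphXn !rmorph_nat.
transitivity ((class_stabilizer N M0)%:R * \sum_(e : {ffun 'I_N -> 'I_M})
    `|\det (\matrix_(i, j < N) (w ^+ e i * tnth z i) ^+ j)| ^+ 2 : R[i]).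
  congr (_ * _); apply: eq_bigr => e _; rewrite [LHS]vandermonde_sqrE.
  congr (`|\det _| ^+ 2); apply/matrixP => i j; rewrite !mxE.
  by rewrite tnth_mktuple.
rewrite (sum_rotations_perms M0 w_prim); congr (_ * _); apply: eq_bigr => p _.
rewrite (vandermonde_part_block _
  (S := fun k : 'I_M => residue_class N M k.+1)); last first.
  by move=> i k; exact: residue_classE.
rewrite rmorph_prod normr_prod -prodrXl; apply: eq_bigr => k _.
rewrite (norm_det_residue_block (M0 := M0) (k := k)); last first.
  by move=> i; exact: residue_classE.
rewrite exprMn /root_weight rmorphM mulrC [X in _ = X * _]vandermonde_sqrE.
apply: (congr2 *%R).
  congr (`|\det _| ^+ 2); apply/matrixP => i j; rewrite !mxE.
  by rewrite tnth_map !tnth_mktuple.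
rewrite -prodrXl rmorph_prod; apply: eq_bigr => i _.
by rewrite subn1 -exprM mulnC rmorphXn norm_normc !tnth_mktuple.
Qed.

Lemma measurable_vandermonde_sqr n : measurable_fun setT (@vandermonde_sqr R n).
Proof.
apply: measurable_prod => i _.
rewrite [X in measurable_fun _ X](_ : _ =
    fun z : n.-tuple R[i] => \prod_(j < n) if (i < j)%N then normc
      (tnth z i - tnth z j) ^+ 2 else 1); last first.
  by apply/funext => z; rewrite big_mkcond.
apply: measurable_prod => j _; case: (i < j)%N => //.
apply: measurable_funX; apply: (measurableT_comp measurable_normc).
by apply: measurable_funBC; exact: measurable_tnth.
Qed.

Lemma measurable_root_weight M k n : measurable_fun setT (@root_weight M k n).
Proof.
apply: measurable_funM.
  exact: measurableT_comp (@measurable_vandermonde_sqr n)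
    (@measurable_powers R M n).
apply: measurable_prod => i _; apply: measurable_funX.
exact: measurableT_comp measurable_normc (measurable_tnth i).
Qed.

End root_weight.

(** * The exponential factors of the potential as real numbers *)

Section boltzmann_weight.
Context {R : realType}.
Local Open Scope ereal_scope.

(** Without values [-oo] the sum never mixes infinities, and a value [+oo] makes both sides
    vanish. *)
Lemma expeR_oppe_sum (I : finType) (f : I -> \bar R) : (forall i, f i <> -oo) ->
  expeR (- \sum_i f i) = \prod_i expeR (- f i).
Proof.
move=> fNy; suff [] : \sum_i f i <> -oo /\ expeR (- \sum_i f i) = \prod_i expeR
  (- f i) by [].
elim/big_ind2: _ => [|x1 x2 y1 y2|i _]; last by split.
  by rewrite oppe0 expeR0.
move=> [+ <-] [+ <-]; case: x2 => [r| |]//; case: y2 => [s| |]// _ _; split=>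
  //.
- by rewrite -EFinD /= opprD expRD EFinM.
- by rewrite /= mule0.
- by rewrite /= mul0e.
- by rewrite /= mul0e.
Qed.

Variable v : R[i] -> \bar R.
Hypotheses (mv : measurable_fun setT v) (vNy : forall x, v x <> -oo).

(** Real-valued because [density_measure] and [weights] take real functions; no information is lost
    when [v] avoids [-oo]. *)
Definition boltzmann x : R := fine (expeR (- v x)).

Lemma boltzmannE x : expeR (- v x) = (boltzmann x)%:E.
Proof. by rewrite /boltzmann; have := @vNy x; case: (v x). Qed.

Lemma boltzmann_ge0 x : (0 <= boltzmann x)%R.
Proof. by apply: fine_ge0; exact: expeR_ge0. Qed.

Lemma measurable_boltzmann : measurable_fun setT boltzmann.
Proof.
(* Where [v] is [+oo], [fine] returns 0 and the exponential would be 1; the indicator restores the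
   value 0. *)
rewrite (_ : boltzmann = fun x =>
  (expR (- fine (v x)) * \1_[set x | v x \is a fin_num] x)%R).
  apply: measurable_funM.
    apply: (measurableT_comp (@measurable_expR R)); apply: measurable_funN.
    exact: measurableT_comp (fine_measurable measurableT) mv.
  apply: measurable_indic; rewrite -[X in measurable X]setTI.
  exact: emeasurable_fin_num.
apply/funext => x; rewrite /boltzmann indicE.
have := @vNy x; case E : (v x) => [r| |]// _.
  by rewrite mem_set/= ?E// mulr1.
by rewrite memNset/= ?E// mulr0.
Qed.

End boltzmann_weight.

(** * Real-valued weights of the three densities *)

Section weights_of_potential.
Context {R : realType}.
Variable V : R -> \bar R.
Hypotheses (mV : measurable_fun (`[0%R, +oo[ : set R) V)
  (VNy : forall t : R, 0 <= t -> V t <> -oo%E).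
Local Open Scope ereal_scope.
Local Notation mCn := (@lebesgueCn R _).

Lemma measurable_potential (h : R -> R) : measurable_fun setT h ->
  (forall t, 0 <= h t)%R ->
  measurable_fun setT (fun x : R[i] => V (h (normc x))).
Proof.
move=> mh h0; apply: (@measurable_comp _ _ _ _ _ _
  (`[0%R, +oo[%classic : set R) V setT (h \o @ComplexField.Normc.normc R)) =>
  //.
  by move=> _ [x _ <-]; rewrite /= in_itv/= h0.
exact: measurableT_comp mh (@measurable_normc R).
Qed.

Definition eigenvalue_weight (x : R[i]) : R :=
  boltzmann (fun x => V (normc x ^+ 2)%R) x.

Definition power_eigenvalue_weight M (x : R[i]) : R :=
  boltzmann (fun x => V (normc x `^ (2 / M%:R))%R) x.

Lemma eigenvalue_weight_ge0 x : (0 <= eigenvalue_weight x)%R.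
Proof. exact: boltzmann_ge0. Qed.

Lemma power_eigenvalue_weight_ge0 M x : (0 <= power_eigenvalue_weight M x)%R.
Proof. exact: boltzmann_ge0. Qed.

Lemma measurable_eigenvalue_weight : measurable_fun setT eigenvalue_weight.
Proof.
apply: measurable_boltzmann => [|x]; last by apply: VNy;
  rewrite exprn_ge0// normc_ge0.
by apply: (@measurable_potential (fun t => t ^+ 2)%R) => [|t]; rewrite ?sqr_ge0.
Qed.

Lemma measurable_power_eigenvalue_weight M :
  measurable_fun setT (power_eigenvalue_weight M).
Proof.
apply: measurable_boltzmann => [|x]; last by apply: VNy; rewrite powR_ge0.
apply: (@measurable_potential (fun t => t `^ (2 / M%:R))%R) => [|t];
  rewrite ?powR_ge0//.
Qed.

Definition ginibre_weight n (z : n.-tuple R[i]) : R :=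
  (vandermonde_sqr z * \prod_(i < n) eigenvalue_weight (tnth z i))%R.

Definition root_law_weight M k n (s : n.-tuple R[i]) : R :=
  (root_weight M k s * \prod_(i < n) eigenvalue_weight (tnth s i))%R.

Definition power_law_weight M k n (s : n.-tuple R[i]) : R :=
  (vandermonde_sqr s * \prod_(i < n)
    (normc (tnth s i) `^ (2 * (k%:R - M%:R) / M%:R) *
     power_eigenvalue_weight M (tnth s i)))%R.

Lemma ginibre_densityE n (z : n.-tuple R[i]) :
  ginibre_density V z = (ginibre_weight z)%:E.
Proof.
rewrite /ginibre_density EFinM; congr (_ * _).
rewrite -prodEFin; apply: eq_bigr => i _.
by rewrite -boltzmannE// => x; apply: VNy; rewrite exprn_ge0// normc_ge0.
Qed.

(** Bridges the two forms of the density: the hypothesis of the theorem has the exponential of a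
    sum, [ginibre_density] a product of exponentials. *)
Lemma normalizable_densityE n (z : n.-tuple R[i]) :
  (\prod_(i < n) \prod_(j < n | (i < j)%N) normc (tnth z i - tnth z j) ^+
    2)%R%:E *
    expeR (- \sum_(i < n) V (normc (tnth z i) ^+ 2)%R) = (ginibre_weight z)%:E.
Proof.
rewrite -ginibre_densityE; congr (_ * _); apply: expeR_oppe_sum => i.
by apply: VNy; rewrite exprn_ge0// normc_ge0.
Qed.

Lemma root_densityE N M k (s : #|residue_class N M k|.-tuple R[i]) :
  root_density V s = (root_law_weight M k s)%:E.
Proof.
rewrite /root_density /root_law_weight /root_weight -mulrA -big_split EFinM;
  congr (_ * _).
rewrite -prodEFin; apply: eq_bigr => i _; rewrite EFinM; congr (_ * _).
by rewrite -boltzmannE// => x; apply: VNy; rewrite exprn_ge0// normc_ge0.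
Qed.

Lemma power_densityE N M k (s : #|residue_class N M k|.-tuple R[i]) :
  power_density V s = (power_law_weight M k s)%:E.
Proof.
rewrite /power_density EFinM; congr (_ * _).
rewrite -prodEFin; apply: eq_bigr => i _; rewrite EFinM; congr (_ * _).
by rewrite -boltzmannE// => x; apply: VNy; rewrite powR_ge0.
Qed.

Let measurable_prod_tnth n (f : R[i] -> R) : measurable_fun setT f ->
  measurable_fun setT (fun z : n.-tuple R[i] => \prod_(i < n) f (tnth z i))%R.
Proof.
move=> mf; apply: measurable_prod => i _; apply: (measurableT_comp mf).
exact: measurable_tnth.
Qed.

Lemma vandermonde_sqr_ge0 n (z : n.-tuple R[i]) : (0 <= vandermonde_sqr z)%R.
Proof.
by apply: prodr_ge0 => i _; apply: prodr_ge0 => j _;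
  rewrite exprn_ge0// normc_ge0.
Qed.

Lemma ginibre_weight_ge0 n (z : n.-tuple R[i]) : (0 <= ginibre_weight z)%R.
Proof.
by rewrite mulr_ge0 ?vandermonde_sqr_ge0// prodr_ge0// => i _;
  exact: eigenvalue_weight_ge0.
Qed.

Lemma measurable_ginibre_weight n : measurable_fun setT (@ginibre_weight n).
Proof.
apply: measurable_funM; first exact: measurable_vandermonde_sqr.
by apply: measurable_prod_tnth; exact: measurable_eigenvalue_weight.
Qed.

Lemma root_law_weight_ge0 M k n (s : n.-tuple R[i]) :
  (0 <= root_law_weight M k s)%R.
Proof.
by rewrite mulr_ge0 ?root_weight_ge0// prodr_ge0// => i _;
  exact: eigenvalue_weight_ge0.
Qed.

Lemma measurable_root_law_weight M k n :
  measurable_fun setT (@root_law_weight M k n).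
Proof.
apply: measurable_funM; first exact: measurable_root_weight.
by apply: measurable_prod_tnth; exact: measurable_eigenvalue_weight.
Qed.

Lemma power_law_weight_ge0 M k n (s : n.-tuple R[i]) :
  (0 <= power_law_weight M k s)%R.
Proof.
rewrite mulr_ge0 ?vandermonde_sqr_ge0// prodr_ge0// => i _.
by rewrite mulr_ge0 ?powR_ge0// power_eigenvalue_weight_ge0.
Qed.

Lemma measurable_power_law_weight M k n :
  measurable_fun setT (@power_law_weight M k n).
Proof.
apply: measurable_funM; first exact: measurable_vandermonde_sqr.
apply: (@measurable_prod_tnth n
  (fun x => normc x `^ (2 * (k%:R - M%:R) / M%:R) *
  power_eigenvalue_weight M x)%R).
apply: measurable_funM; last exact: measurable_power_eigenvalue_weight.
exact: measurableT_comp (measurable_powR _) (@measurable_normc R).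
Qed.

(* The integrand is modified on the null set where some coordinate is [0], at
   which the power density has a junk value. *)
Lemma ge0_integral_powers_weight M n (G H : n.-tuple R[i] -> R)
  (F : n.-tuple R[i] -> R) :
  (0 < M)%N ->
  measurable_fun setT G -> (forall z, 0 <= G z)%R ->
  measurable_fun setT H -> (forall z, 0 <= H z)%R ->
  measurable_fun setT F -> (forall z, 0 <= F z)%R ->
  (forall z, (forall i, tnth z i != 0%R) ->
     (G (powers M z) * \prod_(i < n)
       (M%:R * normc (tnth z i) ^+ (2 * (M - 1))%N) =
      M%:R ^+ n * H z)%R) ->
  \int[mCn]_z (F z * G z)%:E =
  (M%:R ^+ n)%:E * \int[mCn]_z (F (powers M z) * H z)%:E.
Proof.
move=> M0 mG G0 mH H0 mF F0 GH.
have mP := @measurable_powers R M n.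
have J0 (x : R[i]) : (0 <= M%:R * normc x ^+ (2 * (M - 1)))%R.
  by rewrite mulr_ge0// exprn_ge0// normc_ge0.
have mJ : measurable_fun setT (fun x : R[i] =>
  (M%:R * normc x ^+ (2 * (M - 1)))%R).
  by apply: measurable_funM => //; apply: measurable_funX;
    exact: measurable_normc.
rewrite -(@ge0_integral_powers R M n (fun z => (F z * G z)%:E) M0);
  last 2 first.
- by apply/measurable_EFinP; exact: measurable_funM.
- by move=> z; rewrite lee_fin mulr_ge0.
rewrite -ge0_integralZl//; last 2 first.
- apply/measurable_EFinP; apply: measurable_funM => //.
  exact: measurableT_comp mF mP.
- by move=> z _; rewrite lee_fin mulr_ge0.
apply: ge0_ae_eq_integral => //.
- apply/measurable_EFinP; apply: measurable_funM.
    by apply: measurable_funM; [exact: measurableT_comp mF mP|exact: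
      measurableT_comp mG mP].
  exact: (@measurable_prod_tnth n _ mJ).
- apply/measurable_EFinP; apply: measurable_funM => //;
    apply: measurable_funM => //.
  exact: measurableT_comp mF mP.
- by move=> z _; rewrite lee_fin mulr_ge0 ?mulr_ge0 ?prodr_ge0.
- by move=> z _; rewrite lee_fin !mulr_ge0 ?exprn_ge0.
have ae0 : {ae (@lebesgueCn R n), forall z, forall i, tnth z i != 0%R}.
  apply: filter_forall => i.
  pose A (j : 'I_n) : set R[i] := if j == i then [set 0%R] else setT.
  have mA j : measurable (A j).
    rewrite /A; case: ifP => _ //; exact: measurable_complex0.
  exists (box A); split.
  - exact: measurable_box.
  - rewrite [LHS]lebesgueCn_box// (bigD1 i)//= /A eqxx.
    by rewrite [X in X * _]lebesgueC_set1_0 mul0e.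
  - move=> z /= /negP; rewrite negbK => /eqP zi j; rewrite /A.
    by case: eqP => [->|].
apply: filterS ae0 => z z0 _.
by rewrite -!EFinM -mulrA GH// mulrCA.
Qed.

(** Under [z |-> z ^+ M] the exponent of the power density becomes [2 * (k - M)], and the Jacobian
    adds [2 * (M - 1)], for a total of [2 * (k - 1)]. Nonzero coordinates allow exponents of
    opposite signs to be added. *)
Lemma power_law_weight_powers M k n (z : n.-tuple R[i]) : (0 < M)%N ->
  (0 < k)%N ->
  (forall i, tnth z i != 0%R) ->
  (power_law_weight M k (powers M z) *
    \prod_(i < n) (M%:R * normc (tnth z i) ^+ (2 * (M - 1))%N) =
   M%:R ^+ n * root_law_weight M k z)%R.
Proof.
move=> M0 k0 z0; have M0' : (M%:R != 0 :> R)%R by rewrite pnatr_eq0 -lt0n.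
rewrite /power_law_weight /root_law_weight /root_weight.
do 2 rewrite -(mulrA (vandermonde_sqr (powers M z))).
rewrite [RHS]mulrCA; congr (_ * _)%R.
have -> : (M%:R ^+ n = \prod_(i < n) M%:R :> R)%R by rewrite prodr_const
  card_ord.
rewrite -!big_split/=; apply: eq_bigr => i _.
have nz0 : (0 < normc (tnth z i))%R by rewrite lt_neqAle normc_ge0 eq_sym
  normc_eq0 z0.
rewrite tnth_map normcX /power_eigenvalue_weight /eigenvalue_weight /boltzmann
  normcX.
have e (a : R) : ((normc (tnth z i) ^+ M) `^ (a / M%:R) = normc (tnth z i) `^
  a)%R.
  by rewrite -powR_mulrn ?normc_ge0// -powRrM mulrCA divff ?mulr1.
rewrite !e -[(normc _ `^ 2)%R]/(normc _ `^ 2%:R)%R powR_mulrn ?normc_ge0//.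
have <- : (normc (tnth z i) `^ (2 * (k%:R - M%:R)) * normc (tnth z i) ^+
  (2 * (M - 1)) =
    normc (tnth z i) ^+ (2 * (k - 1)))%R.
  rewrite -!powR_mulrn ?normc_ge0// -powRD;
    last by rewrite (gt_eqF nz0) implybT.
  by congr (_ `^ _)%R; rewrite !natrM !natrB//; ring.
ring.
Qed.

End weights_of_potential.

(** * From the density of the eigenvalues to the product of the root densities *)

Section ginibre_root_identity.
Context {R : realType}.
Variables (N M : nat) (V : R -> \bar R).
Hypotheses (M0 : (0 < M)%N) (mV : measurable_fun (`[0%R, +oo[ : set R) V)
  (VNy : forall t : R, 0 <= t -> V t <> -oo%E).
Local Open Scope ereal_scope.
Local Notation mCn := (@lebesgueCn R _).

Definition root_weights (k : 'I_M) : #|residue_class N M k.+1|.-tuple R[i] ->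
  R :=
  @root_law_weight R V M k.+1 #|residue_class N M k.+1|.

Definition power_weights (k : 'I_M) : #|residue_class N M k.+1|.-tuple R[i] ->
  R :=
  @power_law_weight R V M k.+1 #|residue_class N M k.+1|.

Lemma root_weights_ok : weight_ok root_weights.
Proof.
by move=> k; split; [exact: measurable_root_law_weight|exact:
  root_law_weight_ge0].
Qed.

Lemma power_weights_ok : weight_ok power_weights.
Proof.
by move=> k; split; [exact: measurable_power_law_weight|exact:
  power_law_weight_ge0].
Qed.

Lemma prod_residue_class (f : 'I_N -> R) :
  (\prod_(i < N) f i =
   \prod_(k < M) \prod_(j < #|residue_class N M k.+1|) f (enum_val j))%R.
Proof.
rewrite (partition_big (class_of_exponent M0) predT)//=; apply: eq_bigr => k _.
rewrite (eq_bigl (mem (residue_class N M k.+1))); last first.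
  by move=> i; rewrite /= (residue_classE M0).
by rewrite [LHS]big_enum_val.
Qed.

Definition prod_root_weights (z : N.-tuple R[i]) : R :=
  (\prod_(k < M) root_weights (subfamily (residue_class N M k.+1) z))%R.

Definition prod_power_weights (z : N.-tuple R[i]) : R :=
  (\prod_(k < M) power_weights (subfamily (residue_class N M k.+1) z))%R.

Lemma prod_root_weightsE z : prod_root_weights z =
  ((\prod_(k < M) root_weight M k.+1 (subfamily (residue_class N M k.+1) z)) *
   \prod_(i < N) eigenvalue_weight V (tnth z i))%R.
Proof.
rewrite prod_residue_class -big_split; apply: eq_bigr => k _.
by congr (_ * _)%R; apply: eq_bigr => j _; rewrite tnth_mktuple.
Qed.

Lemma prod_root_weights_ge0 z : (0 <= prod_root_weights z)%R.
Proof. by apply: prodr_ge0 => k _; exact: (root_weights_ok k).2. Qed.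

Lemma measurable_prod_root_weights : measurable_fun setT prod_root_weights.
Proof. exact: measurable_prod_subfamily root_weights_ok. Qed.

Lemma prod_power_weights_ge0 z : (0 <= prod_power_weights z)%R.
Proof. by apply: prodr_ge0 => k _; exact: (power_weights_ok k).2. Qed.

Lemma measurable_prod_power_weights : measurable_fun setT prod_power_weights.
Proof. exact: measurable_prod_subfamily power_weights_ok. Qed.

(* Averaging the squared Vandermonde determinant over the rotations of the
   points by [M]-th roots of unity, which fix [F], turns it into a sum over
   permutations of products of the root densities. *)
Lemma ginibre_root_integral : exists2 kappa : R, (0 < kappa)%R &
  forall F : N.-tuple R[i] -> R, measurable_fun setT F ->
    (forall z, 0 <= F z)%R ->
    (forall p z, F (permute_tuple p z) = F z) ->
    (forall z z', powers M z = powers M z' -> F z = F z') ->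
    \int[mCn]_z (F z * ginibre_weight V z)%:E =
    kappa%:E * \int[mCn]_z (F z * prod_root_weights z)%:E.
Proof.
have [K [u [K0 uM u1 uE]]] := @sum_rotations_root_weight R N M M0.
(* The [M ^ N] rotations all give one integral [I1] and the [N!] permutations all give one integral
   [I2], so that [K * M ^ N * I1 = M ^ N * N! * I2]. *)
exists (K%:R^-1 * (N`!)%:R)%R; first by rewrite mulr_gt0 ?invr_gt0 ?ltr0n
  ?fact_gt0.
move=> F mF F0 Fperm Fpow.
pose W (z : N.-tuple R[i]) := (\prod_(i < N) eigenvalue_weight V (tnth z i))%R.
have mW : measurable_fun setT W.
  apply: measurable_prod => i _; apply:
    (measurableT_comp (measurable_eigenvalue_weight mV VNy)).
  exact: measurable_tnth.
have W0 z : (0 <= W z)%R by apply: prodr_ge0 => i _;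
  exact: eigenvalue_weight_ge0.
pose vs z := @vandermonde_sqr R N z.
have vs0 z : (0 <= vs z)%R by exact: vandermonde_sqr_ge0.
have mvs : measurable_fun setT vs by exact: measurable_vandermonde_sqr.
pose rw z := (\prod_(k < M) root_weight M k.+1
  (subfamily (residue_class N M k.+1) z) : R)%R.
have rw0 z : (0 <= rw z)%R by apply: prodr_ge0 => k _; exact: root_weight_ge0.
have mrw : measurable_fun setT rw.
  apply: measurable_prod => k _; apply:
    (measurableT_comp (@measurable_root_weight R M k.+1 _)).
  exact: measurable_subfamily.
have mrot (e : {ffun 'I_N -> 'I_M}) := @measurable_rotate_tuple R N (u \o e).
have mper (p : 'S_N) := @measurable_permute_tuple R N p.
have Frot e z : F (rotate_tuple (u \o e) z) = F z.
  apply: Fpow; apply: eq_from_tnth => i.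
  by rewrite !tnth_map tnth_ord_tuple exprMn uM mul1r.
have Wrot (e : {ffun 'I_N -> 'I_M}) z : W (rotate_tuple (u \o e) z) = W z.
  apply: eq_bigr => i _; rewrite tnth_mktuple /eigenvalue_weight /boltzmann.
  by rewrite ComplexField.Normc.normcM u1 mul1r.
have Wper p z : W (permute_tuple p z) = W z.
  rewrite /W [RHS](reindex_inj (@perm_inj _ p)); apply: eq_bigr => i _.
  by rewrite tnth_mktuple.
(* Only the Vandermonde factor changes under a rotation, and the rotation preserves Lebesgue
   measure. *)
have introt (e : {ffun 'I_N -> 'I_M}) :
    \int[mCn]_z (F z * (vs (rotate_tuple (u \o e) z) * W z))%:E =
    \int[mCn]_z (F z * ginibre_weight V z)%:E.
  rewrite -[RHS](@ge0_integral_rotate_tuple R N (u \o e)) => [|i||z].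
  - by apply: eq_integral => z _; rewrite Frot /ginibre_weight -/(W _) Wrot.
  - exact: u1.
  - apply/measurable_EFinP; apply: measurable_funM => //.
    exact: measurable_ginibre_weight.
  - by rewrite lee_fin mulr_ge0// ginibre_weight_ge0.
have intper (p : 'S_N) : \int[mCn]_z (F z * (rw (permute_tuple p z) * W z))%:E =
    \int[mCn]_z (F z * prod_root_weights z)%:E.
  rewrite -[RHS](@ge0_integral_permute_tuple R N p) => [||z].
  - by apply: eq_integral => z _; rewrite Fperm prod_root_weightsE -/(W _) Wper.
  - apply/measurable_EFinP; apply: measurable_funM => //.
    exact: measurable_prod_root_weights.
  - by rewrite lee_fin mulr_ge0// prod_root_weights_ge0.
pose I1 := \int[mCn]_z (F z * ginibre_weight V z)%:E.
pose I2 := \int[mCn]_z (F z * prod_root_weights z)%:E.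
have cstsum (T : finType) (x : \bar R) : \sum_(t : T) x = (#|T|%:R)%:E * x.
  rewrite big_const; elim: #|T| => [|n IHn]; first by rewrite mul0e.
  by rewrite iterS IHn -nat1r EFinD ge0_muleDl ?lee_fin// mul1e.
have sumint (T : finType) (h : T -> N.-tuple R[i] -> R) :
    (forall t, measurable_fun setT (h t)) -> (forall t z, 0 <= h t z)%R ->
    \int[mCn]_z (F z * ((\sum_t h t z) * W z))%:E =
    \sum_t \int[mCn]_z (F z * (h t z * W z))%:E.
  move=> mh h0; rewrite -ge0_integral_sum//.
  - apply: eq_integral => z _; rewrite sumEFin; congr (_%:E).
    by rewrite mulr_suml mulr_sumr.
  - move=> t; apply/measurable_EFinP; apply: measurable_funM => //.
    exact: measurable_funM.
  - by move=> t z _; rewrite lee_fin !mulr_ge0.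
have main : (K%:R)%:E * ((M%:R ^+ N)%:E * I1) = (M%:R ^+ N)%:E *
  ((N`!)%:R%:E * I2).
  have cR : (M%:R ^+ N = #|{ffun 'I_N -> 'I_M}|%:R :> R)%R.
    by rewrite card_ffun !card_ord natrX.
  have mscaleint (a : R) (h : N.-tuple R[i] -> R) : (0 <= a)%R ->
      measurable_fun setT h -> (forall z, 0 <= h z)%R ->
      a%:E * \int[mCn]_z (F z * (h z * W z))%:E =
      \int[mCn]_z (F z * ((a * h z) * W z))%:E.
    move=> a0 mh h0; rewrite -ge0_integralZl//.
    - by apply: eq_integral => z _; rewrite -EFinM; congr (_%:E); ring.
    - apply/measurable_EFinP; apply: measurable_funM => //.
      exact: measurable_funM.
    - by move=> z _; rewrite lee_fin !mulr_ge0.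
  transitivity ((K%:R)%:E * \int[mCn]_z (F z *
      ((\sum_(e : {ffun 'I_N -> 'I_M}) vs (rotate_tuple (u \o e) z)) * W
        z))%:E).
    congr (_ * _); rewrite sumint; last 2 first.
    - by move=> e; exact: measurableT_comp mvs (mrot e).
    - by move=> e z; exact: vs0.
    by under eq_bigr do rewrite introt; rewrite cstsum -cR.
  rewrite mscaleint//; last 2 first.
  - by apply: measurable_sum => e; exact: measurableT_comp mvs (mrot e).
  - by move=> z; apply: sumr_ge0 => e _; exact: vs0.
  under eq_integral do rewrite uE.
  rewrite -mscaleint ?exprn_ge0//; last 2 first.
  - by apply: measurable_sum => p; exact: measurableT_comp mrw (mper p).
  - by move=> z; apply: sumr_ge0 => p _; exact: rw0.
  congr (_ * _); rewrite sumint; last 2 first.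
  - by move=> p; exact: measurableT_comp mrw (mper p).
  - by move=> p z; exact: rw0.
  by under eq_bigr do rewrite intper; rewrite cstsum card_Sn.
have MN0 : (M%:R ^+ N != 0 :> R)%R by rewrite expf_neq0// pnatr_eq0 -lt0n.
have K0' : (K%:R != 0 :> R)%R by rewrite pnatr_eq0 -lt0n.
have := congr1 (fun x => (K%:R^-1)%:E * (((M%:R ^+ N)^-1)%:E * x)) main.
rewrite /I1 /I2 !muleA -!EFinM.
rewrite (_ : K%:R^-1 * (M%:R ^+ N)^-1 * K%:R * M%:R ^+ N = 1)%R; last first.
  by field; rewrite K0' MN0.
rewrite mul1e => ->; congr (_%:E * _).
by field; rewrite K0' MN0.
Qed.

End ginibre_root_identity.

(** * Laws of point configurations *)

(** As [0 * +oo = 0], a positive product has no zero factor; an infinite factor times a positive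
    rest would then be infinite. *)
Lemma eprod_bounded_factor (R : realType) (I : finType) (a : I -> \bar R) :
  ((forall k, 0 <= a k) -> 0 < \prod_k a k -> \prod_k a k < +oo ->
   forall k, 0 < a k /\ a k < +oo)%E.
Proof.
move=> a0 + + k; rewrite (bigD1 k)//=.
have : (0 <= \prod_(l | l != k) a l)%E by apply: prode_ge0 => l _.
set b := (\prod_(l | _) a l)%E => b0.
have := a0 k; rewrite le_eqVlt => /predU1P[<-|ak]; first by rewrite mul0e ltxx.
move: b0; rewrite le_eqVlt => /predU1P[<-|b0]; first by rewrite mule0 ltxx.
move=> _ ab; split=> //; rewrite ltey; apply: contraTN ab => /eqP ->.
by rewrite gt0_mulye.
Qed.

Section joint_law.
Context {R : realType}.
Variables (N : nat) (I : finType) (S : I -> {set 'I_N}) (c : 'I_N -> I).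
Hypothesis hS : forall i k, (i \in S k) = (c i == k).
Local Open Scope ereal_scope.
Local Notation mCn := (@lebesgueCn R _).
(** Independence gives the law of [z] on boxes as a product over the classes;
    [integral_prod_partition] recognizes it as the integral of the product density, and boxes
    determine the law. *)
Lemma joint_density (g : weights (R := R) S) (gok : weight_ok g) d
  (T : measurableType d) (P : probability T R)
    (z : T -> N.-tuple R[i]) :
  (forall k, has_density_propto P (fun t => subfamily (S k) (z t)) mCn
     (fun s => (g k s)%:E)) ->
  mutually_independent P (fun k t => subfamily (S k) (z t)) ->
  measurable_fun setT z /\ forall E, measurable E ->
    P (z @^-1` E) =
    ((fine (\int[mCn]_x (\prod_k g k (subfamily (S k) x))%:E))^-1)%:E *
    \int[mCn]_x (\1_E x * \prod_k g k (subfamily (S k) x))%:E.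
Proof.
move=> gdens indep; pose G x := (\prod_k g k (subfamily (S k) x))%R.
have mz : measurable_fun setT z.
  apply/measurable_fun_tnthP => i.
  have Sc : i \in S (c i) by rewrite hS.
  have [msub _ _] := gdens (c i).
  rewrite (_ : _ \o z = (@tnth _ R[i])^~ (enum_rank_in Sc i) \o
      (fun t => subfamily (S (c i)) (z t))).
    exact: measurableT_comp (measurable_tnth _) msub.
  by apply/funext => t /=; rewrite tnth_mktuple enum_rankK_in.
split=> // E mE.
have g0 k s : (0 <= g k s)%R := (gok k).2 s.
have mg k : measurable_fun setT (g k) := (gok k).1.
have mG : measurable_fun setT G by exact: measurable_prod_subfamily.
have G0 x : (0 <= G x)%R by apply: prodr_ge0 => k _.
pose Z k := \int[mCn]_s (g k s)%:E.
have Zfin k : Z k \is a fin_num.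
  have [_ [Z0 Zoo] _] := gdens k; rewrite ge0_fin_numE// ltW//.
have ZE : \int[mCn]_x (G x)%:E = (\prod_k fine (Z k))%R%:E.
  rewrite (integral_prod_partition hS gok) -prodEFin.
  by apply: eq_bigr => k _; rewrite fineK.
pose r : R := ((\prod_k fine (Z k))^-1)%R.
have r0 : (0 <= r)%R.
  rewrite invr_ge0 prodr_ge0// => k _; apply: fine_ge0.
  by apply: integral_ge0 => s _; rewrite lee_fin.
rewrite ZE /= -/r.
pose m1 : {measure set (N.-tuple R[i]) -> \bar R} :=
  measure_function_pushforward__canonical__measure_function_Measure P mz.
pose m2 : {measure set (N.-tuple R[i]) -> \bar R} :=
  mscale (NngNum r0) (density_measure (@lebesgueCn R N) mG G0).
have m2E B : m2 B = r%:E * \int[mCn]_x (\1_B x * G x)%:E.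
  by rewrite -integral_indic_weight.
rewrite -m2E -[LHS]/(m1 E).
apply: box_measure_unique => // A mA Aoo; last first.
  by rewrite (le_lt_trans (probability_le1 _ _)) ?ltry//
    -[X in measurable X]setTI; apply: (mz) => //; exact: measurable_box.
have mbox k : measurable (box (restrict_sides A (S := S) (k := k))).
  by apply: measurable_box => j; exact: mA.
rewrite m2E -[LHS]/(P (z @^-1` box A)).
have -> : z @^-1` box A = \bigcap_(k in [set` [set: I]%SET])
    ((fun t => subfamily (S k) (z t)) @^-1` box
      (restrict_sides A (S := S) (k := k))).
  apply/seteqP; split => t.
    move=> zA k _ j; rewrite tnth_mktuple; exact: zA.
  move=> H i; have Sc : i \in S (c i) by rewrite hS.
  have := H (c i); rewrite /= finset.in_setT => /(_ isT (enum_rank_in Sc i)).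
  by rewrite tnth_mktuple /restrict_sides enum_rankK_in.
rewrite (indep [set: I]%SET (fun k =>
  box (restrict_sides A (S := S) (k := k))))//.
pose h : weights (R := R) S := fun k s =>
  (\1_(box (restrict_sides A (S := S) (k := k))) s * g k s)%R.
have hok : weight_ok h.
  move=> k; split=> [|s]; last by rewrite /h mulr_ge0 ?g0.
  by apply: measurable_funM; [apply: measurable_indic; exact: mbox|exact: mg].
transitivity (\prod_k (((fine (Z k))^-1)%R%:E * \int[mCn]_s (h k s)%:E)).
  apply: eq_big => k; first by rewrite finset.in_setT.
  move=> _; have [_ _ ->] := gdens k; last exact: mbox.
  by congr (_ * _); exact: integral_indic_weight.
rewrite big_split /= prodEFin prodfV -/r; congr (_ * _).
rewrite -(integral_prod_partition hS hok); apply: eq_integral => x _.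
by rewrite big_split/= (prod_indic_box hS).
Qed.

End joint_law.

(** * Measurability of events on configurations *)

Section configuration_events.
Context {R : realType}.

Lemma measurable_count_tuple N (A : set R[i]) n : measurable A ->
  measurable [set z : N.-tuple R[i] | count (fun x => x \in A) z = n].
Proof.
move=> mA.
pose f (z : N.-tuple R[i]) : R := \sum_(i < N) \1_A (tnth z i).
have mf : measurable_fun setT f.
  apply: measurable_sum => i; apply: measurableT_comp (measurable_tnth i).
  exact: measurable_indic.
have fE z : f z = (count (fun x => x \in A) z)%:R.
  rewrite -sum1_count big_mkcond natr_sum [in RHS]big_tuple.
  by apply: eq_bigr => i _; rewrite indicE; case: ifP.
rewrite (_ : [set z | _] = setT `&` f @^-1` [set n%:R]); first exact: mf.
rewrite setTI; apply/seteqP; split => z /=; first by move=> zn; rewrite fE zn.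
by move=> /eqP; rewrite fE eqr_nat => /eqP.
Qed.

(** The sets of multisets with measurable preimage form a sigma-algebra [C] that contains the
    counting events, so it contains the generated one. *)
Lemma measurable_configuration N (B : set {mset R[i]}%mset) :
  configuration_measurable B -> measurable
    [set z : N.-tuple R[i] | B (points z)].
Proof.
pose C : set (set {mset R[i]}%mset) :=
  fun B => measurable [set z : N.-tuple R[i] | B (points z)].
move=> cB; apply: (cB C); split; first split; rewrite /C => //=.
- exact: measurable0.
- move=> A mA; rewrite (_ : [set z | _] = ~`
    [set z : N.-tuple R[i] | A (points z)]).
    exact: measurableC.
  by apply/seteqP; split => z /=; [case|split].
- move=> F mF; rewrite (_ : [set z | _] =
      \bigcup_n [set z : N.-tuple R[i] | F n (points z)]).
    exact: bigcup_measurable.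
  by [].
- move=> _ [A mA [n ->]].
  rewrite (_ : [set z | _] = [set z :
    N.-tuple R[i] | count (fun x => x \in A) z = n]).
    exact: measurable_count_tuple.
  suff e z : count (fun x => x \in A) (enum_mset (points z)) =
      count (fun x => x \in A) (z : N.-tuple R[i]).
    by apply/seteqP; split => z /=; rewrite e.
  by have /seq.permP := perm_eq_seq_mset z; exact.
Qed.

Lemma points_permute_tuple N (p : 'S_N) (z : N.-tuple R[i]) :
  points (permute_tuple p z) = points z.
Proof.
by apply/eq_seq_msetP; apply/tuple_permP; exists p.
Qed.

End configuration_events.

(** * Comparison of the laws *)

Section laws_of_powers.
Context {R : realType}.
Variables (N M : nat) (V : R -> \bar R).
Hypotheses (M0 : (0 < M)%N) (mV : measurable_fun (`[0%R, +oo[ : set R) V)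
  (VNy : forall t : R, 0 <= t -> V t <> -oo%E).
Local Open Scope ereal_scope.
Local Notation mCn := (@lebesgueCn R _).
Local Notation prw := (@prod_root_weights R N M V).
Local Notation ppw := (@prod_power_weights R N M V).
Hypothesis V_normalizable :
  normalizable (@lebesgueCn R N) (fun z => (ginibre_weight V z)%:E).

Lemma ginibre_density_weight :
  @ginibre_density R V N = fun z => (ginibre_weight V z)%:E.
Proof. by apply/funext => z; exact: ginibre_densityE. Qed.

Lemma root_density_weight (k : 'I_M) :
  @root_density R V N M k.+1 = fun s => (root_weights V s)%:E.
Proof. by apply/funext => s; exact: root_densityE. Qed.

Lemma power_density_weight (k : 'I_M) :
  @power_density R V N M k.+1 = fun s => (power_weights V s)%:E.
Proof. by apply/funext => s; exact: power_densityE. Qed.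

(** The case [F = 1] of [ginibre_root_integral] transfers positivity and finiteness from the Ginibre
    weight. *)
Lemma integral_prod_root_weights :
  exists2 t : R, (0 < t)%R & \int[mCn]_z (prw z)%:E = t%:E.
Proof.
have [kappa kappa0 /(_ (fun=> 1%R))] := ginibre_root_integral N M0 mV VNy.
move=> /(_ (measurable_cst _) (fun=> ler01) (fun _ _ => erefl)
  (fun _ _ _ => erefl)).
under eq_integral do rewrite mul1r.
under [in RHS]eq_integral do rewrite mul1r.
have [+ +] := V_normalizable => /[swap] + /[swap] e; rewrite e.
case: (\int[mCn]_z (prw z)%:E) => [t| |].
- by rewrite -EFinM lte_fin pmulr_rgt0// => _ t0; exists t.
- by rewrite gt0_muley.
- by rewrite gt0_muleNy.
Qed.

Lemma integral_power_weights (k : 'I_M)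
  (F : #|residue_class N M k.+1|.-tuple R[i] -> R) :
  measurable_fun setT F -> (forall s, 0 <= F s)%R ->
  \int[mCn]_s (F s * power_weights V s)%:E =
  (M%:R ^+ #|residue_class N M k.+1|)%:E *
  \int[mCn]_s (F (powers M s) * root_weights V s)%:E.
Proof.
move=> mF F0; apply: ge0_integral_powers_weight => //.
- exact: (power_weights_ok N mV VNy k).1.
- exact: (power_weights_ok N mV VNy k).2.
- exact: (root_weights_ok N mV VNy k).1.
- exact: (root_weights_ok N mV VNy k).2.
- by move=> s s0; exact: power_law_weight_powers.
Qed.

Lemma integral_prod_power_weights (F : N.-tuple R[i] -> R) :
  measurable_fun setT F -> (forall z, 0 <= F z)%R ->
  \int[mCn]_z (F z * ppw z)%:E =
  (M%:R ^+ N)%:E * \int[mCn]_z (F (powers M z) * prw z)%:E.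
Proof.
move=> mF F0; apply: ge0_integral_powers_weight => //.
- exact: measurable_prod_power_weights.
- exact: prod_power_weights_ge0.
- exact: measurable_prod_root_weights.
- exact: prod_root_weights_ge0.
move=> z z0; rewrite (prod_residue_class M0) -big_split/=.
have -> : (M%:R ^+ N = \prod_(i < N) M%:R :> R)%R by rewrite prodr_const
  card_ord.
rewrite (prod_residue_class M0) -big_split/=; apply: eq_bigr => k _.
rewrite prodr_const card_ord -power_law_weight_powers//; last first.
  by move=> j; rewrite tnth_mktuple.
congr (_ * _)%R; last by apply: eq_bigr => j _; rewrite tnth_mktuple.
congr (power_law_weight _ _ _ _); apply: eq_from_tnth => j.
by rewrite [LHS]tnth_mktuple !tnth_map tnth_ord_tuple.
Qed.

(** The product of these integrals over all [k] is positive and finite, hence so is each of them. *)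
Lemma integral_root_weights (k : 'I_M) :
  exists2 a : R, (0 < a)%R & \int[mCn]_s (@root_weights R N M V k s)%:E = a%:E.
Proof.
have [t t0 tE] := integral_prod_root_weights.
have := integral_prod_partition (residue_classE M0) (root_weights_ok N mV VNy).
rewrite tE => pE.
have ge0 l : 0 <= \int[mCn]_s (@root_weights R N M V l s)%:E.
  by apply: integral_ge0 => s _; rewrite lee_fin;
    exact: (root_weights_ok N mV VNy l).2.
have := eprod_bounded_factor ge0; rewrite -pE lte_fin t0 ltry => /(_ isT isT k).
case: (\int[mCn]_s _) => [a| |] [] //; rewrite lte_fin => a0 _.
by exists a.
Qed.

Lemma normalizable_root_density (k : 'I_M) :
  normalizable mCn (@root_density R V N M k.+1).
Proof.
have [a a0 aE] := integral_root_weights k.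
by rewrite root_density_weight /normalizable aE lte_fin ltry.
Qed.

Lemma integral_power_weights1 (k : 'I_M) :
  \int[mCn]_s (@power_weights R N M V k s)%:E =
  (M%:R ^+ #|residue_class N M k.+1|)%:E * \int[mCn]_s
    (@root_weights R N M V k s)%:E.
Proof.
have := @integral_power_weights k (fun=> 1%R) (measurable_cst _) (fun=> ler01).
by under eq_integral do rewrite mul1r;
  under [in RHS]eq_integral do rewrite mul1r.
Qed.

Lemma normalizable_power_density (k : 'I_M) :
  normalizable mCn (@power_density R V N M k.+1).
Proof.
have [a a0 aE] := integral_root_weights k.
rewrite power_density_weight /normalizable integral_power_weights1 aE -EFinM
  lte_fin ltry.
by rewrite mulr_gt0// exprn_gt0// ltr0n.
Qed.

(** The substitution multiplies the integral over an event and the total mass by the same power of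
    [M]. *)
Lemma power_law_of_root_law (k : 'I_M) d (T : measurableType d)
    (P : probability T R) (X : T -> #|residue_class N M k.+1|.-tuple R[i]) :
  root_law V P X -> power_law V P (fun t => powers M (X t)).
Proof.
move=> [mX _ PX]; split; first exact: measurableT_comp
  (@measurable_powers R M _) mX.
  exact: normalizable_power_density.
move=> A mA; pose B := @powers R M #|residue_class N M k.+1| @^-1` A.
have mB : measurable B.
  by rewrite -[X in measurable X]setTI; exact: measurable_powers.
have [a a0 aE] := integral_root_weights k.
have := PX B mB; rewrite root_density_weight aE => PXB.
transitivity ((a^-1)%R%:E * \int[mCn]_s
  (\1_B s * @root_weights R N M V k s)%:E).
  by rewrite -integral_indic_weight; exact: PXB.
have AE : \int[mCn]_(s in A) (@power_weights R N M V k s)%:E =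
    (M%:R ^+ #|residue_class N M k.+1|)%:E *
    \int[mCn]_s (\1_B s * @root_weights R N M V k s)%:E.
  rewrite integral_indic_weight.
  by apply: (@integral_power_weights k (\1_A)) => //; exact: measurable_indic.
rewrite power_density_weight AE integral_power_weights1 aE muleA -!EFinM /=.
congr (_%:E * _).
by rewrite invfM mulrAC mulVf ?mul1r// expf_neq0// pnatr_eq0 -lt0n.
Qed.

(** The next three laws are all expressed through this indicator with the same right-hand side, so
    the equalities in law follow by comparison. *)
Let F (B : set {mset R[i]}%mset) (z : N.-tuple R[i]) : R :=
  \1_[set z : N.-tuple R[i] | B (points z)] z.

Let measurable_F B : configuration_measurable B -> measurable_fun setT (F B).
Proof. by move=> mB; apply: measurable_indic;
  exact: measurable_configuration. Qed.

(** An event on the configuration of the powers is invariant under permutations and depends only on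
    the powers, so [ginibre_root_integral] applies; [kappa] cancels against the normalization. *)
Lemma ginibre_power_law d (T : measurableType d) (P : probability T R)
    (lambda : T -> N.-tuple R[i]) (B : set {mset R[i]}%mset) :
  ginibre_law V P lambda -> configuration_measurable B ->
  P [set t | B (points (powers M (lambda t)))] =
  ((fine (\int[mCn]_z (prw z)%:E))^-1)%:E *
    \int[mCn]_z (F B (powers M z) * prw z)%:E.
Proof.
move=> [mlambda _ Plambda] mB.
pose E : set (N.-tuple R[i]) := [set z | B (points (powers M z))].
have mE : measurable E.
  rewrite -[X in measurable X]setTI.
  exact: (@measurable_powers R M N measurableT _
    (@measurable_configuration R N B mB)).
have [kappa kappa0 kE] := ginibre_root_integral N M0 mV VNy.
have [t t0 tE] := integral_prod_root_weights.
have intE : \int[@lebesgueCn R N]_z (\1_E z * ginibre_weight V z)%:E =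
    kappa%:E * \int[@lebesgueCn R N]_z (\1_E z * prw z)%:E.
  apply: kE => [|z|p z|z z' zz'].
  - exact: measurable_indic.
  - by [].
  - rewrite !indicE; congr ((_ : bool)%:R).
    have Ep : points (powers M (permute_tuple p z)) = points (powers M z).
      rewrite -[RHS](points_permute_tuple p); congr points;
        apply: eq_from_tnth => i.
      by rewrite [RHS]tnth_mktuple !tnth_map tnth_ord_tuple.
    by apply/idP/idP => /set_mem zE; apply/mem_set; move: zE; rewrite /E /= Ep.
  - rewrite !indicE; congr ((_ : bool)%:R).
    by apply/idP/idP => /set_mem zE; apply/mem_set; move: zE; rewrite /E /= zz'.
have int1 : \int[@lebesgueCn R N]_z (ginibre_weight V z)%:E = (kappa * t)%:E.
  have := kE (fun=> 1%R) (measurable_cst _) (fun=> ler01)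
    (fun _ _ => erefl) (fun _ _ _ => erefl).
  under eq_integral do rewrite mul1r.
  under [in RHS]eq_integral do rewrite mul1r.
  by rewrite tE.
have := Plambda E mE; rewrite ginibre_density_weight int1 => PE.
transitivity ((((kappa * t)^-1)%R)%:E *
    (kappa%:E * \int[@lebesgueCn R N]_z (\1_E z * prw z)%:E)).
  by rewrite -intE -integral_indic_weight; exact: PE.
rewrite tE muleA -!EFinM /=; congr (_%:E * _).
by rewrite invfM mulrAC mulVf ?mul1r// gt_eqF.
Qed.

Lemma root_family_power_law d (T : measurableType d) (P : probability T R)
    (z : T -> N.-tuple R[i]) (B : set {mset R[i]}%mset) :
  (forall k : 'I_M, root_law V P (fun t => residue_subfamily M k.+1 (z t))) ->
  mutually_independent P (fun (k : 'I_M) t => residue_subfamily M k.+1 (z t)) ->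
  configuration_measurable B ->
  P [set t | B (points (powers M (z t)))] =
  ((fine (\int[mCn]_z (prw z)%:E))^-1)%:E *
    \int[mCn]_z (F B (powers M z) * prw z)%:E.
Proof.
move=> zlaw zindep mB.
have dens k : has_density_propto P
    (fun t => subfamily (residue_class N M (k : 'I_M).+1) (z t)) mCn
    (fun s => (root_weights V s)%:E).
  by have := zlaw k; rewrite /root_law root_density_weight.
have [_ Pz] := joint_density (residue_classE M0) (root_weights_ok N mV VNy) dens
  zindep.
pose E : set (N.-tuple R[i]) := [set z | B (points (powers M z))].
have mE : measurable E.
  rewrite -[X in measurable X]setTI.
  exact: (@measurable_powers R M N measurableT _
    (@measurable_configuration R N B mB)).
exact: Pz E mE.
Qed.

(** The joint density of the power families is pulled back along [powers M]; the factor [M ^ N]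
    cancels against the normalization. *)
Lemma power_family_law d (T : measurableType d) (P : probability T R)
    (w : T -> N.-tuple R[i]) (B : set {mset R[i]}%mset) :
  (forall k : 'I_M, power_law V P (fun t => residue_subfamily M k.+1 (w t))) ->
  mutually_independent P (fun (k : 'I_M) t => residue_subfamily M k.+1 (w t)) ->
  configuration_measurable B ->
  P [set t | B (points (w t))] =
  ((fine (\int[mCn]_z (prw z)%:E))^-1)%:E *
    \int[mCn]_z (F B (powers M z) * prw z)%:E.
Proof.
move=> wlaw windep mB.
have dens k : has_density_propto P
    (fun t => subfamily (residue_class N M (k : 'I_M).+1) (w t)) mCn
    (fun s => (power_weights V s)%:E).
  by have := wlaw k; rewrite /power_law power_density_weight.
have [_ Pw] := joint_density (residue_classE M0) (power_weights_ok N mV VNy)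
  dens windep.
have PE := Pw _ (@measurable_configuration R N B mB).
have [t t0 tE] := integral_prod_root_weights.
have int1 : \int[@lebesgueCn R N]_z (ppw z)%:E = (M%:R ^+ N * t)%:E.
  have := @integral_prod_power_weights (fun=> 1%R) (measurable_cst _)
    (fun=> ler01).
  under eq_integral do rewrite mul1r.
  under [in RHS]eq_integral do rewrite mul1r.
  by rewrite tE.
transitivity (((fine (\int[@lebesgueCn R N]_z (ppw z)%:E))^-1)%R%:E *
    \int[@lebesgueCn R N]_z (F B z * ppw z)%:E); first exact: PE.
have F0 z : (0 <= F B z)%R by rewrite /F indicE.
have -> := @integral_prod_power_weights (F B) (measurable_F mB) F0.
rewrite int1 tE muleA -!EFinM /=; congr (_%:E * _).
by rewrite invfM mulrAC mulVf ?mul1r// expf_neq0// pnatr_eq0 -lt0n.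
Qed.

End laws_of_powers.

Unset Implicit Arguments.
Set Strict Implicit.
Set Printing Implicit Defensive.
Theorem theorem3p5 (R : realType) (M N : nat) (M1 : (1 <= M)%N)
    (MN : (M <= N)%N) (V : R -> \bar R)
    (V_measurable : measurable_fun (`[0, +oo[ : set R) V)
    (V_neq_ninfty : forall t : R, 0 <= t -> V t <> -oo%E)
    (V_normalizable : normalizable (@lebesgueCn R N)
       (fun z => ((\prod_(i < N) \prod_(j < N | (i < j)%N)
                     ComplexField.Normc.normc (tnth z i - tnth z j) ^+ 2)%:E *
                  expeR (- \sum_(i < N)
                     V (ComplexField.Normc.normc (tnth z i) ^+ 2)%R))%E)) :
  [/\ forall k : 'I_M,
        normalizable (@lebesgueCn R _) (@root_density R V N M k.+1) /\
        normalizable (@lebesgueCn R _) (@power_density R V N M k.+1),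
      forall (k : 'I_M)
        (d : measure_display) (T : measurableType d) (P : probability T R)
        (X : T -> #|residue_class N M k.+1|.-tuple R[i]),
        root_law V P X -> power_law V P (fun t => powers M (X t)),
      forall (d : measure_display) (T : measurableType d)
        (P : probability T R) (lambda : T -> N.-tuple R[i])
        (d' : measure_display) (T' : measurableType d')
        (P' : probability T' R) (z : T' -> N.-tuple R[i]),
        ginibre_law V P lambda ->
        (forall k : 'I_M,
           root_law V P' (fun t => residue_subfamily M k.+1 (z t))) ->
        mutually_independent P'
          (fun (k : 'I_M) t => residue_subfamily M k.+1 (z t)) ->
        eq_in_law P P' (fun t => points (powers M (lambda t)))
                       (fun t => points (powers M (z t))) &
      forall (d : measure_display) (T : measurableType d)
        (P : probability T R) (lambda : T -> N.-tuple R[i])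
        (d' : measure_display) (T' : measurableType d')
        (P' : probability T' R) (w : T' -> N.-tuple R[i]),
        ginibre_law V P lambda ->
        (forall k : 'I_M,
           power_law V P' (fun t => residue_subfamily M k.+1 (w t))) ->
        mutually_independent P'
          (fun (k : 'I_M) t => residue_subfamily M k.+1 (w t)) ->
        eq_in_law P P' (fun t => points (powers M (lambda t)))
                       (fun t => points (w t))].
Proof.
have Vnorm : normalizable (@lebesgueCn R N) (fun z => (ginibre_weight V z)%:E).
  move: V_normalizable; congr normalizable; apply/funext => z.
  exact: normalizable_densityE.
split.
- move=> k; split; first exact: normalizable_root_density.
  exact: normalizable_power_density.
- by move=> k d T P X; exact: power_law_of_root_law.
- move=> d T P lambda d' T' P' z glaw zlaw zindep B mB.
  transitivity (P [set t | B (points (powers M (lambda t)))]) => //.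
  rewrite (ginibre_power_law M1 V_measurable V_neq_ninfty Vnorm glaw mB).
  by rewrite -(root_family_power_law M1 V_measurable V_neq_ninfty zlaw zindep
    mB).
- move=> d T P lambda d' T' P' w glaw wlaw windep B mB.
  transitivity (P [set t | B (points (powers M (lambda t)))]) => //.
  rewrite (ginibre_power_law M1 V_measurable V_neq_ninfty Vnorm glaw mB).
  by rewrite -(power_family_law M1 V_measurable V_neq_ninfty Vnorm wlaw windep
    mB).
Qed.
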